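(* Let $R$ be a commutative ring and $I \subset R$ a T-nilpotent ideal. Then a flat $R$-module $F$ is finitely quite flat if and only if the $R/I$-module $F/IF$ is finitely quite flat.
   Context: An ideal $I$ is T-nilpotent if for every sequence $a_1,a_2,\dots$ of elements of $I$ there is $n$ with $a_1a_2\cdots a_n=0$. A module $F$ over a commutative ring $R$ is finitely quite flat if there exist finitely many countable multiplicative subsets $S_1,\dots,S_m \subseteq R$ such that $F$ is a direct summand of an $R$-module that is a transfinite extension of modules isomorphic to $R, S_1^{-1}R, \dots, S_m^{-1}R$. (A module $M$ is a transfinite extension of modules from a class $\mathcal C$ if there is a chain of submodules $(M_\alpha\mid\alpha\le\sigma)$ with $M_0=0$, $M_\sigma=M$, $M_\alpha=\bigcup_{\beta<\alpha}M_\beta$ for limit $\alpha$, and each $M_{\alpha+1}/M_\alpha$ isomorphic to a member of $\mathcal C$.) *)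

(* Defs.v *)
From HB Require Import structures.
From mathcomp Require Import all_boot all_order all_algebra.
Set Implicit Arguments.
Unset Strict Implicit.
Unset Printing Implicit Defensive.
Import GRing.Theory.
Local Open Scope ring_scope.

Section ModuleDefs.
Variable R : comPzRingType.

Definition is_linear (M N : lmodType R) (f : M -> N) : Prop :=
  forall (a : R) (x y : M), f (a *: x + y) = a *: f x + f y.

Definition is_bilinear (M N P : lmodType R) (b : M -> N -> P) : Prop :=
  (forall y, is_linear (fun x => b x y)) /\ (forall x, is_linear (b x)).

Definition is_tensor (M N T : lmodType R) (b : M -> N -> T) : Prop :=
  is_bilinear b /\
  forall (P : lmodType R) (g : M -> N -> P), is_bilinear g ->
    (exists h : T -> P, is_linear h /\ forall x y, h (b x y) = g x y) /\
    (forall h1 h2 : T -> P,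
        is_linear h1 -> (forall x y, h1 (b x y) = g x y) ->
        is_linear h2 -> (forall x y, h2 (b x y) = g x y) ->
        forall t, h1 t = h2 t).

Definition flat (F : lmodType R) : Prop :=
  forall (N' N T' T : lmodType R) (f : N' -> N) (b' : N' -> F -> T')
         (b : N -> F -> T) (h : T' -> T),
    is_linear f -> injective f ->
    is_tensor b' -> is_tensor b ->
    is_linear h -> (forall x y, h (b' x y) = b (f x) y) ->
    injective h.

Definition countable_mult_subset (S : R -> Prop) : Prop :=
  S 1 /\ (forall s t, S s -> S t -> S (s * t)) /\
  exists e : nat -> R, forall s, S s -> exists n, e n = s.

Definition iso_to_R (C : lmodType R) : Prop :=
  exists f : R -> C,
    (forall a r r', f (a * r + r') = a *: f r + f r') /\ bijective f.

(* C is isomorphic to the module of fractions S^-1 R: q r s is the image of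
   the fraction r/s (s in S); q is onto, identifies exactly the equivalent
   fractions, and transports the module operations of S^-1 R. *)
Definition iso_to_loc (S : R -> Prop) (C : lmodType R) : Prop :=
  exists q : R -> R -> C,
    (forall c, exists r s, S s /\ q r s = c) /\
    (forall r s r' s', S s -> S s' ->
       (q r s = q r' s' <-> exists t, S t /\ t * (r * s' - r' * s) = 0)) /\
    (forall r s r' s', S s -> S s' ->
       q r s + q r' s' = q (r * s' + r' * s) (s * s')) /\
    (forall a r s, S s -> a *: q r s = q (a * r) s).

Definition submodule (G : lmodType R) (A : G -> Prop) : Prop :=
  A 0 /\ forall a x y, A x -> A y -> A (a *: x + y).

Definition quotient_iso (G : lmodType R) (B A : G -> Prop) (C : lmodType R)
  : Prop :=
  exists f : G -> C,
    (forall a x y, B x -> B y -> f (a *: x + y) = a *: f x + f y) /\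
    (forall c, exists x, B x /\ f x = c) /\
    (forall x, B x -> (f x = 0 <-> A x)).

Definition well_order (O : Type) (lt : O -> O -> Prop) : Prop :=
  (forall x y z, lt x y -> lt y z -> lt x z) /\
  (forall x y, x = y \/ lt x y \/ lt y x) /\
  well_founded lt.

(* G is a transfinite extension of modules satisfying P (a class of modules):
   a chain (M_alpha | alpha <= sigma) indexed by a well-ordered set O with
   greatest element sigma. *)
Definition transfinite_extension (G : lmodType R) (P : lmodType R -> Prop)
  : Prop :=
  exists (O : Type) (lt : O -> O -> Prop) (sigma : O) (M : O -> G -> Prop),
    well_order lt /\
    (forall a, lt a sigma \/ a = sigma) /\
    (forall a, submodule (M a)) /\
    (forall a b, lt a b -> forall x, M a x -> M b x) /\
    (forall a, (forall b, ~ lt b a) -> forall x, M a x <-> x = 0) /\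
    (forall x, M sigma x) /\
    (* continuity at limit ordinals *)
    (forall a, (exists b, lt b a) ->
               (forall b, lt b a -> exists c, lt b c /\ lt c a) ->
               forall x, M a x <-> exists b, lt b a /\ M b x) /\
    (* successor steps: b = a + 1 *)
    (forall a b, lt a b -> (forall c, lt a c -> c = b \/ lt b c) ->
       exists C : lmodType R, P C /\ quotient_iso (M b) (M a) C).

Definition direct_summand (F G : lmodType R) : Prop :=
  exists (i : F -> G) (p : G -> F),
    is_linear i /\ is_linear p /\ forall x, p (i x) = x.

Definition finitely_quite_flat (F : lmodType R) : Prop :=
  exists (m : nat) (S : 'I_m -> R -> Prop),
    (forall j, countable_mult_subset (S j)) /\
    exists G : lmodType R,
      transfinite_extension G
        (fun C => iso_to_R C \/ exists j, iso_to_loc (S j) C) /\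
      direct_summand F G.

Definition ideal (I : R -> Prop) : Prop :=
  I 0 /\ (forall a b, I a -> I b -> I (a + b)) /\
  (forall r a, I a -> I (r * a)).

Definition T_nilpotent (I : R -> Prop) : Prop :=
  forall a : nat -> R, (forall n, I (a n)) ->
    exists n, \prod_(i < n) a i = 0.

Definition ideal_times (I : R -> Prop) (F : lmodType R) (x : F) : Prop :=
  exists s : seq (R * F),
    (forall u, u \in s -> I u.1) /\ x = \sum_(u <- s) u.1 *: u.2.

End ModuleDefs.

(* Main.v *)
Require Import Defs.
From HB Require Import structures.
From mathcomp Require Import all_boot all_order all_algebra.
From mathcomp Require Import generic_quotient.
From mathcomp Require Import boolp functions.
From mathcomp Require wochoice.
From mathcomp Require Import ring.
Set Implicit Arguments.
Unset Strict Implicit.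
Unset Printing Implicit Defensive.
Import GRing.Theory.
Local Open Scope ring_scope.
Local Open Scope quotient_scope.

(**
If [S] is generated by [e 0, e 1, ...] and [t n = e 0 * ... * e n], then [S^-1 R]
is the colimit of [R --t 0--> R --t 1--> R --> ...]; hence [Ext^1(S^-1 R, C) = 0]
means that all systems [x n - t n *: x n.+1 = c n] are solvable in [C], and a
transfinite extension [G] of such modules is the cokernel of a triangular
injective endomorphism [rho] of a free module [Q].

Reducing that presentation modulo [I] gives one direction.  For the other one,
a presentation of a module having [F/IF] as a direct summand is lifted to [R];
this yields a free module [Q] with a surjection [q : Q -> F].  Flatness and
T-nilpotence (linear maps congruent to the identity modulo [I] are invertible)
show that [L = ker q] is projective, so [F] has projective dimension at most 1.

It remains to extend maps [L -> C] to [Q] when [C] solves the systems of all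
products of the given multiplicative sets.  Writing a map as
[a n = c n \o io + t n *: a n.+1] one passes from [C] to the quotients [C / t n]
and to the module of coherent sequences [Hom(S^-1 R, C)]; after treating all the
sets, each of them acts on [C] invertibly or has an element that annihilates [C].
Such modules form a subcategory with free objects, where extendability modulo
[I] lifts by T-nilpotence.

Finally, adjoining universal solutions of systems, one product of the sets at a
time and smaller products first, turns [Q -> F] into a surjection [G -> F]
with [G] a transfinite extension and a kernel of the above kind; it splits.
*)

(** * Linear maps, submodules and quotients *)

(** The main obstacle is the extension of maps [L -> C]. If [C] solves all systems then so does
    [C/IC], so the extension exists modulo [I]; but the error of a lift is a map from [L] into [IC],
    and T-nilpotence applies only to an endomorphism of one fixed module. So a universal module
    under [L] is needed, in a class that contains [C] and whose members solve the systems even after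
    reduction modulo [I]. Prescribing which scalars act bijectively and which act as zero defines
    such a class; this is why [C] is first dismantled, one multiplicative set at a time.

    Dismantling is also what forces products of sets: a [t']-system in the coherent [t]-sequences of
    [C] is solved through a [t' t]-system in [C]. Subsets of ['I_m] index all the products that
    occur, so finitely many localizations suffice for [G]. Adjoining solutions for one product
    enlarges the kernel and could spoil the products treated before; but the new elements are
    divisible by the new scalars modulo the old kernel, which turns a problem for [J] into one for a
    strictly larger set of indices. *)

Inductive lexp (R : Type) : Type :=
| LVar of nat | LZero | LAdd of lexp R & lexp R | LOpp of lexp R
| LScale of R & lexp R.
Arguments LVar {R} _.
Arguments LZero {R}.

Section LmodReflect.
Variables (R : comPzRingType) (M : lmodType R).

Fixpoint lval (s : seq M) (e : lexp R) : M :=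
  match e with
  | LVar i => nth 0 s i
  | LZero => 0
  | LAdd a b => lval s a + lval s b
  | LOpp a => - lval s a
  | LScale r a => r *: lval s a
  end.

Fixpoint lcoef (e : lexp R) (i : nat) : R :=
  match e with
  | LVar j => if eqn i j then 1 else 0
  | LZero => 0
  | LAdd a b => lcoef a i + lcoef b i
  | LOpp a => - lcoef a i
  | LScale r a => r * lcoef a i
  end.

Lemma lvalE s e : lval s e = \sum_(i < size s) lcoef e i *: nth 0 s i.
Proof.
elim: e => [j||a IHa b IHb|a IHa|r a IHa] /=.
- have [jlt|jge] := ltnP j (size s).
    rewrite (bigD1 (Ordinal jlt)) //= (_ : eqn j j) ?scale1r; last by apply/eqnP.
    rewrite big1 ?addr0 // => i /negP ij.
    by case: eqnP => [eij|]; [case: ij; apply/eqP/val_inj | rewrite scale0r].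
  rewrite nth_default // big1 // => i _.
  case: eqnP => [eij|]; last by rewrite scale0r.
  by move: (ltn_ord i); rewrite eij ltnNge jge.
- by rewrite big1 // => i _; rewrite scale0r.
- by rewrite IHa IHb -big_split; apply: eq_bigr => i _; rewrite scalerDl.
- by rewrite IHa -sumrN; apply: eq_bigr => i _; rewrite scaleNr.
- by rewrite IHa scaler_sumr; apply: eq_bigr => i _; rewrite scalerA.
Qed.

Fixpoint lcheck (n : nat) (a b : nat -> R) : Prop :=
  match n with 0 => True | n'.+1 => a 0%N = b 0%N /\ lcheck n' (a \o succn) (b \o succn) end.

(** Basis of the tactic [lmod]: an identity between linear combinations follows from equality of the
    coefficients of each atom, left to [ring]. [lcheck] is recursive so that [cbn] unfolds it to a
    plain conjunction. *)
Lemma lval_eq s a b : lcheck (size s) (lcoef a) (lcoef b) -> lval s a = lval s b.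
Proof.
move=> H; rewrite !lvalE; apply: eq_bigr => i _; congr (_ *: _).
elim: (size s) (lcoef a) (lcoef b) H i => [|n IH] f g /=; first by move=> _ [].
by move=> [H0 H] [[|i] ilt] //=; exact: (IH _ _ H (Ordinal (ilt : (i < n)%N))).
Qed.
End LmodReflect.

Ltac lm_mem x l := lazymatch l with
  | nil => constr:(false)
  | cons x _ => constr:(true)
  | cons _ ?l' => lm_mem x l'
  end.
Ltac lm_add x l := let b := lm_mem x l in
  lazymatch b with true => l | false => constr:(cons x l) end.
Ltac lm_atoms e l := lazymatch e with
  | @GRing.add _ ?a ?b => let l1 := lm_atoms a l in lm_atoms b l1
  | @GRing.opp _ ?a => lm_atoms a l
  | @GRing.scale _ _ _ ?a => lm_atoms a l
  | @GRing.zero _ => l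
  | _ => lm_add e l
  end.
Ltac lm_idx x l := lazymatch l with
  | cons x _ => constr:(0%N)
  | cons _ ?l' => let n := lm_idx x l' in constr:(S n)
  end.
Ltac lm_reify R e l := lazymatch e with
  | @GRing.add _ ?a ?b => let a' := lm_reify R a l in let b' := lm_reify R b l in
      constr:(LAdd a' b')
  | @GRing.opp _ ?a => let a' := lm_reify R a l in constr:(LOpp a')
  | @GRing.scale _ _ ?r ?a => let a' := lm_reify R a l in constr:(@LScale R r a')
  | @GRing.zero _ => constr:(@LZero R)
  | _ => let i := lm_idx e l in constr:(@LVar R i)
  end.
Ltac lmod_of R M := lazymatch goal with |- ?a = ?b =>
  let T := type of a in
  let l0 := lm_atoms a constr:(@nil T) in
  let l := lm_atoms b l0 in
  let a' := lm_reify R a l in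
  let b' := lm_reify R b l in
  change (@lval R M l a' = @lval R M l b'); apply: lval_eq;
  cbn [lcheck size lcoef comp eqn];
  repeat split; ring end.
Ltac lmod := lazymatch goal with |- @eq ?T _ _ =>
  let T' := eval simpl in T in
  lazymatch T' with
  | @GRing.Lmodule.sort (GRing_ComPzRing__to__GRing_PzRing ?R) ?M => lmod_of R M
  end end.

Section Linear.
Variables (R : comPzRingType) (M N P : lmodType R).
Implicit Types (f : M -> N) (g : N -> P).

Lemma lin0 f : is_linear f -> f 0 = 0.
Proof.
move=> Hf; have := Hf (-1) 0 0.
by rewrite scaler0 addr0 scaleN1r addNr.
Qed.
Lemma linD f : is_linear f -> forall x y, f (x + y) = f x + f y.
Proof. by move=> Hf x y; have := Hf 1 x y; rewrite !scale1r. Qed.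
Lemma linZ f : is_linear f -> forall a x, f (a *: x) = a *: f x.
Proof. by move=> Hf a x; have := Hf a x 0; rewrite lin0 // !addr0. Qed.
Lemma linN f : is_linear f -> forall x, f (- x) = - f x.
Proof. by move=> Hf x; rewrite -scaleN1r linZ // scaleN1r. Qed.
Lemma linB f : is_linear f -> forall x y, f (x - y) = f x - f y.
Proof. by move=> Hf x y; rewrite linD // linN. Qed.
Lemma lin_sum f : is_linear f -> forall (I : Type) (s : seq I) (Q : pred I) (F : I -> M),
  f (\sum_(i <- s | Q i) F i) = \sum_(i <- s | Q i) f (F i).
Proof.
move=> Hf I s Q F; elim: s => [|i s IH]; first by rewrite !big_nil lin0.
by rewrite !big_cons; case: ifP => _; rewrite ?linD // IH.
Qed.
Lemma lin_id : is_linear (fun x : M => x). Proof. by []. Qed.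
Lemma lin_comp g f : is_linear g -> is_linear f -> is_linear (fun x => g (f x)).
Proof. by move=> Hg Hf a x y; rewrite Hf Hg. Qed.
Lemma lin_add f f' : is_linear f -> is_linear f' -> is_linear (fun x => f x + f' x).
Proof. by move=> Hf Hg a x y; rewrite Hf Hg; lmod. Qed.
Lemma lin_sub f f' : is_linear f -> is_linear f' -> is_linear (fun x => f x - f' x).
Proof. by move=> Hf Hg a x y; rewrite Hf Hg; lmod. Qed.
Lemma lin_scale r f : is_linear f -> is_linear (fun x => r *: f x).
Proof. by move=> Hf a x y; rewrite Hf; lmod. Qed.
Lemma lin_zero : is_linear (fun _ : M => 0 : N).
Proof. by move=> a x y; lmod. Qed.
End Linear.
Arguments lin_id {R M}.
Arguments lin_zero {R M N}.

Section Submodule.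
Variables (R : comPzRingType) (M : lmodType R).
Implicit Types A B : M -> Prop.

Lemma sub0 A : submodule A -> A 0. Proof. by case. Qed.
Lemma subD A : submodule A -> forall x y, A x -> A y -> A (x + y).
Proof. by move=> [_ H] x y Ax Ay; rewrite -[x]scale1r; apply: H. Qed.
Lemma subZ A : submodule A -> forall a x, A x -> A (a *: x).
Proof. by move=> [H0 H] a x Ax; rewrite -[_ *: _]addr0; apply: H. Qed.
Lemma subB A : submodule A -> forall x y, A x -> A y -> A (x - y).
Proof. by move=> H x y Ax Ay; apply: subD => //; rewrite -scaleN1r; apply: subZ. Qed.
Lemma sub_big A (I : Type) (s : seq I) (P : pred I) (F : I -> M) :
  submodule A -> (forall i, P i -> A (F i)) -> A (\sum_(i <- s | P i) F i).
Proof.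
by move=> HA HF; apply: (big_ind A) => //; [exact: sub0 | exact: subD].
Qed.
Lemma sub_eq A : submodule A -> forall x y, A (x - y) -> A y -> A x.
Proof. by move=> H x y Axy Ay; rewrite -(subrK y x); apply: subD. Qed.

(** Encoded as the intersection of all submodules containing [X], so that a membership proof is
    itself an induction principle. *)
Definition lspan (X : M -> Prop) (x : M) : Prop :=
  forall A, submodule A -> (forall y, X y -> A y) -> A x.
Lemma lspan_sub X : submodule (lspan X).
Proof.
split=> [A HA _|a x y Hx Hy A HA HX]; first exact: sub0.
by case: (HA) => _; apply; [apply: Hx | apply: Hy].
Qed.
Lemma lspan_gen (X : M -> Prop) x : X x -> lspan X x.
Proof. by move=> Xx A HA; apply. Qed.
Lemma lspan_mono (X Y : M -> Prop) x :
  (forall y, X y -> Y y) -> lspan X x -> lspan Y x.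
Proof. by move=> XY Hx A HA HY; apply: Hx => // y /XY/HY. Qed.

Lemma ker_sub (N : lmodType R) (f : M -> N) :
  is_linear f -> submodule (fun x => f x = 0).
Proof.
move=> Hf; split=> [|a x y fx fy]; first exact: lin0.
by rewrite Hf fx fy scaler0 addr0.
Qed.
Lemma preim_sub (N : lmodType R) (f : M -> N) (A : N -> Prop) :
  is_linear f -> submodule A -> submodule (fun x => A (f x)).
Proof.
move=> Hf [A0 HA]; split=> [|a x y fx fy]; first by rewrite lin0.
by rewrite Hf; apply: HA.
Qed.
Lemma im_sub (N : lmodType R) (f : N -> M) :
  is_linear f -> submodule (fun x => exists y, x = f y).
Proof.
move=> Hf; split=> [|a x y [u ->] [v ->]]; first by exists 0; rewrite lin0.
by exists (a *: u + v); rewrite Hf.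
Qed.
End Submodule.

Section IdealTimes.
Variables (R : comPzRingType) (I : R -> Prop) (M : lmodType R).

Lemma ideal_timesP (x : M) : ideal_times I x <->
  lspan (fun y => exists a z, I a /\ y = a *: z) x.
Proof.
split=> [[s [Hs ->]] A HA HI|].
  rewrite big_seq; apply: sub_big => // u us; apply: HI.
  by exists u.1, u.2; split=> //; apply: Hs.
apply=> [|y [a [z [Ia ->]]]]; last first.
  exists [:: (a, z)]; split; last by rewrite big_seq1.
  by move=> u; rewrite inE => /eqP->.
split; first by exists [::]; rewrite big_nil.
move=> a x1 x2 [s1 [H1 ->]] [s2 [H2 ->]].
exists ([seq (u.1, a *: u.2) | u <- s1] ++ s2); split.
  by move=> u; rewrite mem_cat => /orP [/mapP [v /H1 Hv ->]|/H2].
rewrite big_cat big_map scaler_sumr /=; congr (_ + _).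
by apply: eq_bigr => u _; rewrite !scalerA mulrC.
Qed.

Lemma it_sub : submodule (@ideal_times R I M).
Proof.
have -> : @ideal_times R I M = lspan (fun y => exists a z, I a /\ y = a *: z).
  by apply/funext => x; apply/propext; exact: ideal_timesP.
exact: lspan_sub.
Qed.
Lemma it_gen a (x : M) : I a -> ideal_times I (a *: x).
Proof. by move=> Ia; apply/ideal_timesP; apply: lspan_gen; exists a, x. Qed.
Lemma it_ind (A : M -> Prop) : submodule A ->
  (forall a z, I a -> A (a *: z)) -> forall x, ideal_times I x -> A x.
Proof. by move=> HA H x /ideal_timesP; apply=> // y [a [z [Ia ->]]]; apply: H. Qed.
End IdealTimes.

Lemma it_lin (R : comPzRingType) (I : R -> Prop) (M N : lmodType R) (f : M -> N) :
  is_linear f -> forall x, ideal_times I x -> ideal_times I (f x).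
Proof.
move=> Hf; apply: it_ind => [|a z Ia]; first exact: (preim_sub Hf (it_sub _ _)).
by rewrite linZ //; apply: it_gen.
Qed.

Lemma it_surj (R : comPzRingType) (I : R -> Prop) (M N : lmodType R) (f : M -> N) :
  is_linear f -> (forall y, exists x, f x = y) ->
  forall y, ideal_times I y -> exists x, ideal_times I x /\ f x = y.
Proof.
move=> Hf fs; apply: it_ind => [|a z Ia].
  split=> [|a y z [u [Iu <-]] [v [Iv <-]]].
    by exists 0; split; [exact: (sub0 (it_sub _ _)) | exact: lin0].
  exists (a *: u + v); split; last exact: Hf.
  by case: (it_sub I M) => _; apply.
have [x <-] := fs z; exists (a *: x); split; [exact: it_gen | exact: linZ].
Qed.

Section Quotient.
Variables (R : comPzRingType) (M : lmodType R) (A : M -> Prop).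
Hypothesis HA : submodule A.

Definition qrel (x y : M) : bool := `[< A (x - y) >].
Lemma qrel_refl : reflexive qrel.
Proof. by move=> x; apply/asboolP; rewrite subrr; exact: sub0. Qed.
Lemma qrel_sym : symmetric qrel.
Proof.
by move=> x y; apply/asboolP/asboolP => H; rewrite -opprB -sub0r;
  apply: subB => //; exact: sub0.
Qed.
Lemma qrel_trans : transitive qrel.
Proof.
move=> y x z /asboolP Hxy /asboolP Hyz; apply/asboolP.
by rewrite -(subrKA y); apply: subD.
Qed.
Canonical qrel_equiv := EquivRel qrel qrel_refl qrel_sym qrel_trans.
Definition qmod := {eq_quot qrel}.
HB.instance Definition _ := Choice.on qmod.
Definition qpi (x : M) : qmod := \pi_qmod x.
Lemma qpiP x y : qpi x = qpi y <-> A (x - y).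
Proof. by split=> [/eqquotP/asboolP|H] //; apply/eqquotP/asboolP. Qed.
Lemma qpi_surj (u : qmod) : exists x, qpi x = u.
Proof. by exists (repr u); exact: reprK. Qed.
Definition qadd (u v : qmod) : qmod := qpi (repr u + repr v).
Definition qopp (u : qmod) : qmod := qpi (- repr u).
Definition qscale (a : R) (u : qmod) : qmod := qpi (a *: repr u).
Lemma qrepr x : A (repr (qpi x) - x).
Proof. by apply/qpiP; exact: reprK. Qed.
Lemma qaddE x y : qadd (qpi x) (qpi y) = qpi (x + y).
Proof.
apply/qpiP; set x' := repr _; set y' := repr _.
have -> : x' + y' - (x + y) = (x' - x) + (y' - y) by lmod.
by apply: subD => //; exact: qrepr.
Qed.
Lemma qoppE x : qopp (qpi x) = qpi (- x).
Proof.
apply/qpiP; set x' := repr _; have -> : - x' - - x = (-1) *: (x' - x) by lmod.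
by apply: subZ => //; exact: qrepr.
Qed.
Lemma qscaleE a x : qscale a (qpi x) = qpi (a *: x).
Proof. by apply/qpiP; rewrite -scalerBr; apply: subZ => //; exact: qrepr. Qed.
Lemma qaddA : associative qadd.
Proof.
move=> u v w; have [x <-] := qpi_surj u; have [y <-] := qpi_surj v.
by have [z <-] := qpi_surj w; rewrite !qaddE addrA.
Qed.
Lemma qaddC : commutative qadd.
Proof. by move=> u v; rewrite /qadd addrC. Qed.
Lemma qadd0 : left_id (qpi 0) qadd.
Proof. by move=> u; have [x <-] := qpi_surj u; rewrite qaddE add0r. Qed.
Lemma qaddN : left_inverse (qpi 0) qopp qadd.
Proof. by move=> u; have [x <-] := qpi_surj u; rewrite qoppE qaddE addNr. Qed.
HB.instance Definition _ := GRing.isZmodule.Build qmod qaddA qaddC qadd0 qaddN.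
Lemma qscaleA a b u : qscale a (qscale b u) = qscale (a * b) u.
Proof. by have [x <-] := qpi_surj u; rewrite !qscaleE scalerA. Qed.
Lemma qscale1 : left_id 1 qscale.
Proof. by move=> u; have [x <-] := qpi_surj u; rewrite qscaleE scale1r. Qed.
Lemma qscaleDr : right_distributive qscale +%R.
Proof.
move=> a u v; have [x <-] := qpi_surj u; have [y <-] := qpi_surj v.
by rewrite /GRing.add /= !(qscaleE, qaddE) scalerDr.
Qed.
Lemma qscaleDl u : {morph qscale^~ u : a b / a + b}.
Proof.
move=> a b; have [x <-] := qpi_surj u.
by rewrite {2}/GRing.add /= !(qscaleE, qaddE) scalerDl.
Qed.
HB.instance Definition _ :=
  GRing.Zmodule_isLmodule.Build R qmod qscaleA qscale1 qscaleDr qscaleDl.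

Lemma quotient_exists : exists (Q : lmodType R) (f : M -> Q),
  is_linear f /\ (forall u, exists x, f x = u) /\ (forall x, f x = 0 <-> A x).
Proof.
exists qmod, qpi; split; last first.
  by split=> [|x]; [exact: qpi_surj | rewrite -[A x]/(A x) -[x in A x]subr0; exact: qpiP].
move=> a x y; rewrite -qaddE -qscaleE; reflexivity.
Qed.
End Quotient.

(** * Submodules, free modules, tensor products, germs, scalars *)

Section Subtype.
Variables (R : comPzRingType) (M : lmodType R) (A : M -> Prop).
Hypothesis HA : submodule A.

Definition smod := {x : M | `[< A x >]}.
HB.instance Definition _ := Choice.on smod.
Definition smk x (Ax : A x) : smod := exist _ x (asboolT Ax).
Lemma smodP (u : smod) : A (sval u). Proof. exact: (asboolW (proj2_sig u)). Qed.
Lemma smod_inj (u v : smod) : sval u = sval v -> u = v. Proof. exact: val_inj. Qed.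
Definition sadd (u v : smod) : smod := smk (subD HA (smodP u) (smodP v)).
Definition sopp (u : smod) : smod := smk (subZ HA (-1) (smodP u)).
Definition sscale (a : R) (u : smod) : smod := smk (subZ HA a (smodP u)).
Definition szero : smod := smk (sub0 HA).
Lemma saddA : associative sadd.
Proof. by move=> u v w; apply: smod_inj; rewrite /= addrA. Qed.
Lemma saddC : commutative sadd.
Proof. by move=> u v; apply: smod_inj; rewrite /= addrC. Qed.
Lemma sadd0 : left_id szero sadd.
Proof. by move=> u; apply: smod_inj; rewrite /= add0r. Qed.
Lemma saddN : left_inverse szero sopp sadd.
Proof. by move=> u; apply: smod_inj; rewrite /= scaleN1r addNr. Qed.
HB.instance Definition _ := GRing.isZmodule.Build smod saddA saddC sadd0 saddN.
Lemma sscaleA a b u : sscale a (sscale b u) = sscale (a * b) u.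
Proof. by apply: smod_inj; rewrite /= scalerA. Qed.
Lemma sscale1 : left_id 1 sscale.
Proof. by move=> u; apply: smod_inj; rewrite /= scale1r. Qed.
Lemma sscaleDr : right_distributive sscale +%R.
Proof. by move=> a u v; apply: smod_inj; rewrite /= scalerDr. Qed.
Lemma sscaleDl u : {morph sscale^~ u : a b / a + b}.
Proof. by move=> a b; apply: smod_inj; rewrite /= scalerDl. Qed.
HB.instance Definition _ :=
  GRing.Zmodule_isLmodule.Build R smod sscaleA sscale1 sscaleDr sscaleDl.

Lemma submodule_exists : exists (K : lmodType R) (f : K -> M),
  is_linear f /\ injective f /\ (forall x, A x <-> exists k, f k = x).
Proof.
exists smod, sval; split; first by [].
split; first exact: smod_inj.
by move=> x; split=> [Ax|[k <-]]; [exists (smk Ax) | exact: smodP].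
Qed.
End Subtype.

Definition free_on (R : comPzRingType) (T : Type) (Q : lmodType R) (e : T -> Q) : Prop :=
  (forall (M : lmodType R) (g : T -> M),
     exists h : Q -> M, is_linear h /\ forall t, h (e t) = g t) /\
  (forall A : Q -> Prop, submodule A -> (forall t, A (e t)) -> forall x, A x).

(* The equational criterion for flatness, in a form where the relation
   [l = \sum_j d_j x_j] with [\sum_i a_i d_j i = 0] is a membership in a lspan. *)
Definition eq_flat (R : comPzRingType) (Q : lmodType R) : Prop :=
  forall n (a : 'I_n -> R) (l : 'I_n -> Q), \sum_i a i *: l i = 0 ->
    lspan (fun y : 'I_n -> Q => exists d x,
      \sum_i a i * d i = 0 /\ y = (fun i => d i *: x)) l.

Lemma free_exists (R : comPzRingType) (T : Type) :
  exists (Q : lmodType R) (e : T -> Q), free_on e /\ eq_flat Q.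
Proof.
(* Classically every type has a decidable equality; supports can then be handled as duplicate-free
   lists. *)
elim/Peq: T => T.
pose fs (f : T -> R^o) := exists s : seq T, forall x, x \notin s -> f x = 0.
have fs_sub : submodule fs.
  split=> [|a f g [s Hs] [s' Hs']]; first by exists [::].
  exists (s ++ s') => x; rewrite mem_cat negb_or => /andP [xs xs'].
  by rewrite -[LHS]/(a *: f x + g x) Hs // Hs' // scaler0 addr0.
have [Q [io [io_lin [io_inj io_im]]]] := submodule_exists fs_sub.
have fsQ q : exists s : seq T, uniq s /\ forall x, x \notin s -> io q x = 0.
  have /io_im [s Hs] : exists k, io k = io q by exists q.
  by exists (undup s); split=> [|x]; rewrite ?undup_uniq // mem_undup; exact: Hs.
have fe t : fs (fun x => (x == t)%:R).
  by exists [:: t] => x; rewrite inE => /negbTE ->.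
have /choice [e eE] : forall t, exists q, io q = (fun x => (x == t)%:R).
  by move=> t; apply/io_im.
have [sp spP] := choice fsQ.
have decomp q s : uniq s -> (forall x, x \notin s -> io q x = 0) ->
    q = \sum_(x <- s) io q x *: e x.
  move=> us Hs; apply: io_inj; rewrite lin_sum //; apply/funext => y.
  rewrite fct_sumE.
  have H x : io (io q x *: e x) y = io q x * (y == x)%:R.
    by rewrite linZ // eE.
  under eq_bigr do rewrite H.
  have [ys|yNs] := boolP (y \in s).
    rewrite (bigD1_seq y) //= eqxx mulr1 big1 ?addr0 // => x.
    by rewrite eq_sym => /negbTE ->; rewrite mulr0.
  rewrite Hs // big_seq big1 // => x xs; case: eqP => [yx|]; last by rewrite mulr0.
  by move: yNs; rewrite yx xs.
exists Q, e; split; last first.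
  move=> n a l Hl.
  (* Over a common support [s] the relation holds coordinate by coordinate, so [l] is a sum over [x]
     in [s] of a relation-compatible coefficient vector times [e x]. *)
  pose s := undup (flatten [seq sp (l i) | i <- enum 'I_n]).
  have Hs i x : x \notin s -> io (l i) x = 0.
    rewrite mem_undup => Hx; apply: (spP (l i)).2; apply: contra Hx => xs.
    by apply/flattenP; exists (sp (l i)) => //; apply: map_f; rewrite mem_enum.
  have -> : l = \sum_(x <- s) (fun i => io (l i) x *: e x).
    apply/funext => i; rewrite fct_sumE.
    by apply: decomp; [exact: undup_uniq | exact: Hs].
  apply: sub_big => [|x _]; first exact: lspan_sub.
  apply: lspan_gen; exists (fun i => io (l i) x), (e x); split=> //.
  have : io (\sum_i a i *: l i) x = 0 by rewrite Hl lin0.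
  rewrite lin_sum // fct_sumE => H; rewrite -[RHS]H; apply: eq_bigr => i _.
  by rewrite linZ.
split=> [M g|A HA He x]; last first.
  rewrite (decomp x (sp x) (spP x).1 (spP x).2).
  by apply: sub_big => // t _; apply: subZ.
pose h (q : Q) : M := \sum_(x <- sp q) io q x *: g x.
(* The sum does not depend on the chosen support, as only nonzero coordinates count; additivity then
   follows over a common support. *)
have hE q s : uniq s -> (forall x, x \notin s -> io q x = 0) ->
    h q = \sum_(x <- s) io q x *: g x.
  move=> us Hs; rewrite /h; have [usp Hsp] := spP q.
  have key r : \sum_(x <- r) io q x *: g x =
      \sum_(x <- [seq x <- r | io q x != 0]) io q x *: g x.
    rewrite big_filter [LHS](bigID (fun x => io q x != 0)) /=.
    by rewrite [X in _ + X]big1 ?addr0 // => x /negbNE/eqP ->; rewrite scale0r.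
  rewrite key [RHS]key; apply: perm_big; apply: uniq_perm; rewrite ?filter_uniq //.
  move=> x; rewrite !mem_filter; case: eqP => //= nz.
  have [xs|/Hs//] := boolP (x \in s).
  by have [//|/Hsp] := boolP (x \in sp q).
exists h; split=> [a q q'|t].
  pose s := undup (sp q ++ sp q').
  have us : uniq s by exact: undup_uniq.
  have Hq x : x \notin s -> io q x = 0.
    by rewrite mem_undup mem_cat negb_or => /andP [/((spP q).2)].
  have Hq' x : x \notin s -> io q' x = 0.
    by rewrite mem_undup mem_cat negb_or => /andP [_ /((spP q').2)].
  have E x : io (a *: q + q') x = a * io q x + io q' x by rewrite io_lin.
  rewrite (hE q s) // (hE q' s) // (hE (a *: q + q') s) //; last first.
    by move=> x xs; rewrite E Hq // Hq' // mulr0 addr0.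
  rewrite scaler_sumr -big_split; apply: eq_bigr => x _.
  by rewrite E scalerDl scalerA.
rewrite (hE (e t) [:: t]) //; last by move=> x; rewrite eE inE => /negbTE ->.
by rewrite big_seq1 eE eqxx scale1r.
Qed.

Lemma lin_ext (R : comPzRingType) (T : Type) (Q : lmodType R) (e : T -> Q)
  (M : lmodType R) (f g : Q -> M) : free_on e -> is_linear f -> is_linear g ->
  (forall t, f (e t) = g (e t)) -> forall x, f x = g x.
Proof.
move=> [_ gen] Hf Hg H x; apply/subr0_eq; move: x.
by apply: gen => [|t]; [exact: ker_sub (lin_sub Hf Hg) | rewrite H subrr].
Qed.

Definition projective (R : comPzRingType) (L : lmodType R) : Prop :=
  forall (E B : lmodType R) (f : E -> B) (g : L -> B),
    is_linear f -> is_linear g -> (forall y, exists x, f (x) = g y) ->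
    exists h : L -> E, is_linear h /\ forall y, f (h y) = g y.

Lemma free_projective (R : comPzRingType) (T : Type) (Q : lmodType R) (e : T -> Q) :
  free_on e -> projective Q.
Proof.
move=> He E B f g Hf Hg fs; have [c cP] := choice (fun t => fs (e t)).
have [h [Hh hE]] := He.1 _ c; exists h; split=> //.
by apply: (lin_ext He) => [||t]; rewrite ?hE //; exact: lin_comp.
Qed.

Lemma lin_inl (R : comPzRingType) (P Q : lmodType R) :
  is_linear (fun x : P => (x, 0) : P * Q).
Proof. by move=> a x y; rewrite -[RHS]/(a *: x + y, a *: 0 + 0) scaler0 addr0. Qed.
Lemma lin_inr (R : comPzRingType) (P Q : lmodType R) :
  is_linear (fun x : Q => (0, x) : P * Q).
Proof. by move=> a x y; rewrite -[RHS]/(a *: 0 + 0, a *: x + y) scaler0 addr0. Qed.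
Lemma pair_split (R : comPzRingType) (P Q : lmodType R) (x : P) (y : Q) :
  (x, y) = (x, 0) + (0, y) :> P * Q.
Proof. by rewrite -[RHS]/(x + 0, 0 + y) addr0 add0r. Qed.

Lemma pair_projective (R : comPzRingType) (P Q : lmodType R) :
  projective P -> projective Q -> projective (P * Q)%type.
Proof.
move=> HP HQ E B f g Hf Hg fs.
have [y|h [Hh hE]] := HP _ _ _ _ Hf (lin_comp Hg (@lin_inl _ P Q)); first exact: fs.
have [y|k [Hk kE]] := HQ _ _ _ _ Hf (lin_comp Hg (@lin_inr _ P Q)); first exact: fs.
exists (fun x => h x.1 + k x.2); split=> [a x y|[x y]] /=.
  by rewrite Hh Hk; lmod.
by rewrite linD // hE kE -linD // -pair_split.
Qed.

Lemma factor_surj (R : comPzRingType) (M N P : lmodType R) (f : M -> N) (g : M -> P) :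
  is_linear f -> (forall y, exists x, f x = y) -> is_linear g ->
  (forall x, f x = 0 -> g x = 0) ->
  exists h : N -> P, is_linear h /\ forall x, h (f x) = g x.
Proof.
move=> Hf fs Hg fg; have [s sP] := choice fs.
have E x : g (s (f x)) = g x.
  by apply/subr0_eq; rewrite -linB //; apply: fg; rewrite linB // sP subrr.
exists (fun y => g (s y)); split=> // a y z.
rewrite -Hg; apply/subr0_eq; rewrite -linB //; apply: fg.
by rewrite linB // Hf !sP subrr.
Qed.

Lemma factor_inj (R : comPzRingType) (M N P : lmodType R) (f : N -> M) (g : P -> M) :
  is_linear f -> injective f -> is_linear g ->
  (forall x, exists y, f y = g x) ->
  exists h : P -> N, is_linear h /\ forall x, f (h x) = g x.
Proof.
move=> Hf fi Hg fg; have [h hE] := choice fg; exists h; split=> // a x y.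
by apply: fi; rewrite Hf !hE Hg.
Qed.

(** The library gives a relation for which every nonempty predicate has a unique least element.
    Totality, antisymmetry and transitivity are read off from sets of two or three elements, and the
    strict part is taken. *)
Lemma well_order_exists (T : Type) : exists lt : T -> T -> Prop, Defs.well_order lt.
Proof.
elim/Peq: T => T; have [r wo] := wochoice.well_ordering_principle T.
pose lt x y := r x y /\ x <> y.
have mini (A : T -> Prop) x : A x -> exists2 z, A z & forall y, A y -> r z y.
  move=> Ax; have [|z [[/asboolP Az zl] _]] := wo (fun y => `[< A y >]).
    by exists x; apply/asboolP.
  by exists z => // y Ay; apply: zl; apply/asboolP.
have total x y : r x y \/ r y x.
  have [|z [->|->] H] := mini (fun z => z = x \/ z = y) x; first by left.
    by left; apply: H; right.
  by right; apply: H; left.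
have anti x y : r x y -> r y x -> x = y.
  move=> xy yx; have [|z [_ uniq]] := wo [pred z | (z == x) || (z == y)].
    by exists x; rewrite inE eqxx.
  have refl w : r w w by case: (total w w).
  rewrite -(uniq x) ?(uniq y) //; (split; first by rewrite inE eqxx ?orbT);
    by move=> w; rewrite inE => /orP [] /eqP ->.
exists lt; split; [|split].
- move=> x y z [xy nxy] [yz nyz].
  have [w Hw Hmin] := mini (fun w => [\/ w = x, w = y | w = z]) x (Or31 _ _ erefl).
  case: Hw => E; subst w.
  + split; first by apply: Hmin; apply: Or33.
    by move=> xz; subst z; apply: nxy; apply: anti.
  + by case: nxy; apply: anti => //; apply: Hmin; apply: Or31.
  + by case: nyz; apply: anti => //; apply: Hmin; apply: Or32.
- move=> x y; have [->|nxy] := EM (x = y); first by left.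
  by right; case: (total x y) => H; [left|right]; split=> // E; apply: nxy.
- move=> x; apply: contrapT => nx.
  have [z nz Hmin] := mini (fun z => ~ Acc lt z) x nx.
  apply: nz; constructor => y [yz nyz]; apply: contrapT => ny.
  by apply: nyz; apply: anti => //; apply: Hmin.
Qed.

Lemma wo_irr (Y : Type) (lt : Y -> Y -> Prop) : Defs.well_order lt -> forall x, ~ lt x x.
Proof.
by move=> [_ [_ wf]] x; elim: {x}(wf x) => x _ IH xx; exact: (IH x xx xx).
Qed.

Lemma wo_min (Y : Type) (lt : Y -> Y -> Prop) (A : Y -> Prop) x :
  Defs.well_order lt -> A x -> exists z, A z /\ forall y, A y -> y = z \/ lt z y.
Proof.
move=> [tr [tot wf]]; elim: {x}(wf x) => x _ IH Ax.
have [[y [yx Ay]]|H] := EM (exists y, lt y x /\ A y); first exact: (IH y).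
exists x; split=> // y Ay; case: (tot y x) => [->|[yx|]]; [by left| |by right].
by case: H; exists y.
Qed.

(** The definition of flatness speaks of tensor products given by their universal property, so
    applying it requires that they exist. *)
Lemma tensor_exists (R : comPzRingType) (M N : lmodType R) :
  exists (T : lmodType R) (b : M -> N -> T), is_tensor b.
Proof.
have [Q [e [[univ gen] _]]] := free_exists R (M * N)%type.
pose rel (z : Q) :=
  (exists a x x' y, z = e (a *: x + x', y) - (a *: e (x, y) + e (x', y))) \/
  (exists a x y y', z = e (x, a *: y + y') - (a *: e (x, y) + e (x, y'))).
have [T [f [Hf [fs fk]]]] := quotient_exists (lspan_sub rel).
exists T, (fun x y => f (e (x, y))); split.
  split=> [y a x x'|x a y y']; apply/subr0_eq; rewrite -Hf -linB //; apply/fk;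
    apply: lspan_gen; [left; by exists a, x, x', y | right; by exists a, x, y, y'].
move=> P g [g1 g2]; split; last first.
  move=> h1 h2 L1 E1 L2 E2 t; have [z <-] := fs t; apply/subr0_eq; move: z.
  apply: (gen (fun z => h1 (f z) - h2 (f z) = 0)) => [|[x y]]; last first.
    by rewrite E1 E2 subrr.
  by apply: (@ker_sub _ _ _ (fun z => h1 (f z) - h2 (f z)));
    apply: lin_sub; exact: lin_comp.
have [h [Hh hE]] := univ P (fun z => g z.1 z.2).
have [|k [Hk kE]] := factor_surj Hf fs Hh.
  move=> z /fk Hz; apply: (Hz _ (ker_sub Hh)) => _ [[a [x [x' [y ->]]]]|[a [x [y [y' ->]]]]]; rewrite linB // Hh !hE /=.
    by rewrite g1 subrr.
  by rewrite g2 subrr.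
by exists k; split=> // x y; rewrite kE hE.
Qed.

Definition system (R : comPzRingType) (M : lmodType R) (t : nat -> R) (c x : nat -> M) :=
  forall n, x n - t n *: x n.+1 = c n.
Definition solvable_for (R : comPzRingType) (t : nat -> R) (M : lmodType R) : Prop :=
  forall c : nat -> M, exists x, system t c x.

Definition tseg (R : comPzRingType) (t : nat -> R) (n k : nat) : R :=
  \prod_(i < k) t (n + i)%N.

Lemma tseg0 (R : comPzRingType) (t : nat -> R) n : tseg t n 0 = 1.
Proof. exact: big_ord0. Qed.
Lemma tsegS (R : comPzRingType) (t : nat -> R) n k :
  tseg t n k.+1 = t n * tseg t n.+1 k.
Proof.
rewrite /tseg big_ord_recl addn0; congr (_ * _).
by apply: eq_bigr => i _; rewrite /= /bump addSnnS.
Qed.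
Lemma tsegSr (R : comPzRingType) (t : nat -> R) n k :
  tseg t n k.+1 = tseg t n k * t (n + k)%N.
Proof. exact: big_ord_recr. Qed.
Lemma tsegD (R : comPzRingType) (t : nat -> R) n k l :
  tseg t n (k + l) = tseg t n k * tseg t (n + k) l.
Proof.
elim: l => [|l IH]; first by rewrite addn0 tseg0 mulr1.
by rewrite addnS !tsegSr IH mulrA addnA.
Qed.

(* The module of germs at infinity of sequences; it plays the role of an
   injective hull, since every telescope system is solvable in it. *)
Lemma germ_exists (R : comPzRingType) (M : lmodType R) :
  exists (D : lmodType R) (germ : (nat -> M) -> D),
    is_linear (germ : (nat -> M) -> D) /\
    (forall d, exists f, germ f = d) /\
    (forall f, germ f = 0 <-> exists N, forall k, (N <= k)%N -> f k = 0) /\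
    (forall t, solvable_for t D).
Proof.
pose ev (f : nat -> M) := exists N, forall k, (N <= k)%N -> f k = 0.
have ev_sub : submodule ev.
  split=> [|a f g [N HN] [N' HN']]; first by exists 0%N.
  exists (maxn N N') => k; rewrite geq_max => /andP [h h'].
  by rewrite -[LHS]/(a *: f k + g k) HN // HN' // scaler0 addr0.
have [D [germ [Hg [gs gk]]]] := quotient_exists ev_sub.
exists D, germ; do 3!split=> //; move=> t c.
have [f fE] := choice (fun n => gs (c n)).
(* Formally [x n] is the infinite series of the [tseg t n i *: c (n + i)]. At place [k] it is cut
   off at index [k]; the equation holds at all places [k > n], hence for germs. *)
pose x n k := \sum_(i < k - n) tseg t n i *: f (n + i)%N k.
exists (fun n => germ (x n)) => n; rewrite -linZ // -linB // -fE.
apply/subr0_eq; rewrite -linB //; apply/gk; exists n.+1 => k nk.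
rewrite -[LHS]/(x n k - t n *: x n.+1 k - f n k) /x.
rewrite -(subnSK nk) big_ord_recl tseg0 scale1r addn0 scaler_sumr.
rewrite [X in _ + X - _ - _](eq_bigr (fun i : 'I_(k - n.+1) =>
  t n *: (tseg t n.+1 i *: f (n.+1 + i)%N k))); last first.
  by move=> i _; rewrite scalerA -tsegS /= /bump addSnnS.
set S := \sum_(_ < _) _; lmod.
Qed.

Section Scalars.
Variables (R R' : comPzRingType) (pi : {rmorphism R -> R'}).

Definition resmod (M : lmodType R') : Type := M.
HB.instance Definition _ (M : lmodType R') := GRing.Zmodule.on (resmod M).
Section Res.
Variable M : lmodType R'.
Definition rscale (a : R) (x : resmod M) : resmod M := pi a *: (x : M).
Lemma rscaleA a b x : rscale a (rscale b x) = rscale (a * b) x.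
Proof. by rewrite /rscale scalerA rmorphM. Qed.
Lemma rscale1 : left_id 1 rscale.
Proof. by move=> x; rewrite /rscale rmorph1 scale1r. Qed.
Lemma rscaleDr : right_distributive rscale +%R.
Proof. by move=> a x y; exact: scalerDr. Qed.
Lemma rscaleDl x : {morph rscale^~ x : a b / a + b}.
Proof. by move=> a b; rewrite /rscale rmorphD scalerDl. Qed.
HB.instance Definition _ :=
  GRing.Zmodule_isLmodule.Build R (resmod M) rscaleA rscale1 rscaleDr rscaleDl.
End Res.

Definition semilinear (M : lmodType R) (M' : lmodType R') (f : M -> M') : Prop :=
  (forall x y, f (x + y) = f x + f y) /\ (forall a x, f (a *: x) = pi a *: f x).

Lemma restrict_exists (M' : lmodType R') : exists (M : lmodType R) (f : M -> M'),
  semilinear f /\ bijective f.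
Proof. by exists (resmod M'), id; split; [split | exists id]. Qed.

Hypothesis pi_surj : forall r', exists r, pi r = r'.
Section Ext.
Variable M : lmodType R.
Hypothesis kills : forall r, pi r = 0 -> forall x : M, r *: x = 0.
Definition extmod : Type := M.
HB.instance Definition _ := GRing.Zmodule.on extmod.
Definition plift (r' : R') : R := sval (cid (pi_surj r')).
Lemma pliftK r' : pi (plift r') = r'. Proof. exact: proj2_sig (cid (pi_surj r')). Qed.
Definition escale (a : R') (x : extmod) : extmod := plift a *: (x : M).
Lemma escaleE r (x : extmod) : escale (pi r) x = r *: (x : M).
Proof.
apply/subr0_eq; rewrite /escale -scalerBl; apply: kills.
by rewrite rmorphB pliftK subrr.
Qed.
Lemma escaleA a b x : escale a (escale b x) = escale (a * b) x.
Proof.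
have [r <-] := pi_surj a; have [s <-] := pi_surj b.
by rewrite -rmorphM !escaleE scalerA.
Qed.
Lemma escale1 : left_id 1 escale.
Proof. by move=> x; rewrite -(rmorph1 pi) escaleE scale1r. Qed.
Lemma escaleDr : right_distributive escale +%R.
Proof. by move=> a x y; exact: scalerDr. Qed.
Lemma escaleDl x : {morph escale^~ x : a b / a + b}.
Proof.
move=> a b; have [r <-] := pi_surj a; have [s <-] := pi_surj b.
by rewrite -rmorphD !escaleE; exact: scalerDl.
Qed.
HB.instance Definition _ :=
  GRing.Zmodule_isLmodule.Build R' extmod escaleA escale1 escaleDr escaleDl.

Lemma extend_exists : exists (M' : lmodType R') (f : M -> M'),
  semilinear f /\ bijective f.
Proof.
exists extmod, id; split; last by exists id.
by split=> // a x; rewrite -[RHS]/(escale (pi a) x) escaleE.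
Qed.
End Ext.
End Scalars.

(** * T-nilpotent ideals and flatness *)

Section TNilpotent.
Variables (R : comPzRingType) (I : R -> Prop).
Hypothesis HT : T_nilpotent I.

(** T-nilpotence as a principle of dependent choice: a property that can always be carried on past
    one more factor from [I] would reach a vanishing product. *)
Lemma tnil_choice (X : Type) (P : R -> X -> Prop) :
  (forall a x, P a x -> exists b y, I b /\ P (a * b) y) ->
  (forall x, ~ P 0 x) -> forall x, ~ P 1 x.
Proof.
move=> step P0 x Px.
have /choice [F FP] : forall s : R * X, exists by_ : R * X,
    P s.1 s.2 -> I by_.1 /\ P (s.1 * by_.1) by_.2.
  move=> [a y]; have [Pay|nP] := EM (P a y); last by exists (a, y).
  by have [b [z H]] := step _ _ Pay; exists (b, z).
pose nxt s := (s.1 * (F s).1, (F s).2).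
pose st n := iter n nxt (1, x).
have stP n : P (st n).1 (st n).2 by elim: n => //= n IH; exact: (FP _ IH).2.
have [n Hn] := HT (fun n => (FP _ (stP n)).1).
have stE k : (st k).1 = \prod_(i < k) (F (st i)).1.
  by elim: k => [|k IH]; rewrite ?big_ord0 // big_ord_recr -IH.
by apply: (P0 (st n).2); move: (stP n); rewrite {1}stE Hn.
Qed.

(** If [a *: x] is not in [A], then modulo [A] it is a sum of terms [(a * b) *: z] with [b] in [I],
    one of which is not in [A] either; [tnil_choice] excludes this. *)
Lemma tnil_nakayama (M : lmodType R) (A : M -> Prop) : submodule A ->
  (forall x, exists y, A y /\ ideal_times I (x - y)) -> forall x, A x.
Proof.
move=> HA H x; apply: contrapT; rewrite -[x]scale1r.
apply: (@tnil_choice _ (fun a x => ~ A (a *: x))) => {x} [a x nA|x]; last first.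
  by apply; rewrite scale0r; exact: sub0.
have [y [Ay [s [Is xE]]]] := H x.
apply: contrapT => nex; apply: nA.
have -> : a *: x = a *: y + \sum_(u <- s) (a * u.1) *: u.2.
  under eq_bigr do rewrite -scalerA.
  by rewrite -scaler_sumr -xE -scalerDr addrC subrK.
apply: subD => //; first exact: subZ.
rewrite big_seq; apply: sub_big => // u us.
by apply: contrapT => nA; apply: nex; exists u.1, u.2; split=> //; apply: Is.
Qed.

(** The property carried along is that [a] annihilates no iterate of [z]. If it could not be carried
    on, each of the finitely many terms of [nu z] would die at some stage, and a common stage would
    annihilate an iterate of [z]. *)
Lemma tnil_loc_nilpotent (M : lmodType R) (nu : M -> M) : is_linear nu ->
  (forall z, ideal_times I (nu z)) -> forall z, exists k, iter k nu z = 0.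
Proof.
move=> Hnu nuI z; apply: contrapT => nz.
have iter_lin k : is_linear (iter k nu).
  by elim: k => [|k IH] a x y /=; rewrite ?IH ?Hnu.
apply: (@tnil_choice _ (fun a z => forall k, a *: iter k nu z <> 0) _ _ z);
  last by move=> k; rewrite scale1r => kz; apply: nz; exists k.
- move=> {z nz} a z nz; have [s [Is zE]] := nuI z.
  apply: contrapT => nex.
  have dead u : u \in s -> exists k, (a * u.1) *: iter k nu u.2 = 0.
    move=> us; apply: contrapT => H; apply: nex; exists u.1, u.2.
    by split=> [|k kz]; [exact: Is | apply: H; exists k].
  have [K HK] : exists K, forall u, u \in s -> (a * u.1) *: iter K nu u.2 = 0.
    elim: s dead {Is zE} => [|u s IH] dead; first by exists 0%N.
    have [|K HK] := IH; first by move=> v vs; apply: dead; rewrite inE vs orbT.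
    have [k kz] := dead u (mem_head _ _).
    exists (k + K)%N => v; rewrite inE => /orP [/eqP ->|vs].
      by rewrite addnC iterD -linZ // kz lin0.
    by rewrite iterD -linZ // HK // lin0.
  apply: (nz K.+1); rewrite iterSr zE lin_sum // scaler_sumr big_seq big1 // => u us.
  by rewrite linZ // scalerA HK.
- by move=> x /(_ 0%N); rewrite scale0r.
Qed.

(** Local nilpotence makes the geometric series of [nu] finite at each element, so [1 - nu] is
    bijective. *)
Lemma tnil_unipotent (M : lmodType R) (nu : M -> M) : is_linear nu ->
  (forall z, ideal_times I (nu z)) ->
  exists w : M -> M, is_linear w /\ (forall z, w (z - nu z) = z).
Proof.
move=> Hnu nuI; have nil := tnil_loc_nilpotent Hnu nuI.
have Hf : is_linear (fun z => z - nu z) by apply: lin_sub.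
have inj : injective (fun z => z - nu z).
  move=> x y /eqP; rewrite -subr_eq0 => /eqP E; apply/subr0_eq.
  have {}E : nu (x - y) = x - y.
    by apply/subr0_eq; rewrite linB // -[RHS]oppr0 -E; lmod.
  have [k] := nil (x - y); elim: k => //= k IH.
  by rewrite -iterS iterSr E.
have surj z : exists y, y - nu y = z.
  have [k Hk] := nil z; exists (\sum_(i < k) iter i nu z).
  rewrite (lin_sum Hnu) -sumrB (eq_bigr (fun i : 'I_k => iter i nu z - iter i.+1 nu z)) //.
  transitivity (z - iter k nu z); last by rewrite Hk subr0.
  elim: k {Hk} => [|k IH]; first by rewrite big_ord0 subrr.
  by rewrite big_ord_recr IH /=; lmod.
have [w wE] := choice surj; exists w; split=> [a x y|z]; last first.
  by apply: inj; rewrite /= wE.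
by apply: inj; rewrite Hf /= !wE.
Qed.
End TNilpotent.

Lemma lspan_map (R : comPzRingType) (M N : lmodType R) (f : M -> N)
  (X : M -> Prop) (Y : N -> Prop) : is_linear f ->
  (forall x, X x -> lspan Y (f x)) -> forall x, lspan X x -> lspan Y (f x).
Proof. by move=> Hf XY x Hx; exact: (Hx _ (preim_sub Hf (lspan_sub Y))). Qed.

Section Flat.
Variables (R : comPzRingType) (F Q : lmodType R) (q : Q -> F).
Hypotheses (Hflat : flat F) (Hq : is_linear q) (qs : forall y, exists x, q x = y).

(* Exactness of [- (x) ker q -> - (x) Q -> - (x) F] applied to a submodule [A]
   of [R^n], written inside [Q^n]. *)
Lemma flat_lspan n (A : ('I_n -> R^o) -> Prop) (y : 'I_n -> Q) : submodule A ->
  lspan (fun z : 'I_n -> Q => exists d x, A d /\ z = (fun i => d i *: x)) y ->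
  (forall i, q (y i) = 0) ->
  lspan (fun z : 'I_n -> Q => exists d x, A d /\ q x = 0 /\ z = (fun i => d i *: x)) y.
Proof.
move=> HA Hy qy; set AL := lspan _.
have [N' [io [Hio [io_inj io_im]]]] := submodule_exists HA.
have [T' [b' Hb']] := tensor_exists N' F.
have [T [b Hb]] := tensor_exists ('I_n -> R^o : lmodType R) F.
have [h [Hh hE]] : exists h : T' -> T, is_linear h /\
    forall x z, h (b' x z) = b (io x) z.
  suff bil : is_bilinear (fun x z => b (io x) z) by exact: (Hb'.2 T _ bil).1.
  by split=> [z a x x'|x]; [rewrite Hio Hb.1.1 | exact: Hb.1.2].
have hinj : injective h := Hflat Hio io_inj Hb' Hb Hh hE.
have [W [om [Hom [oms omk]]]] := @quotient_exists R ('I_n -> Q : lmodType R) AL (lspan_sub _).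
have [s sE] := choice qs.
have omE (d : 'I_n -> R^o) x x' : A d -> q x = q x' ->
    om (fun i => d i *: x) = om (fun i => d i *: x').
  move=> Ad E; apply/subr0_eq; rewrite -linB //; apply/omk; apply: lspan_gen.
  exists d, (x - x'); split=> //; split; first by rewrite linB // E subrr.
  by apply/funext => i; rewrite scalerBr.
have Aio x : A (io x) by apply/io_im; exists x.
(* [k] sends the tensor of [d] and [f] to the class of [d] times any lift of [f]: two lifts differ
   by an element of [ker q], hence by an element of [AL]. *)
have [k [Hk kE]] : exists k : T' -> W, is_linear k /\
    forall x f, k (b' x f) = om (fun i => io x i *: s f).
  suff bil : is_bilinear (fun x f => om (fun i => io x i *: s f)).
    exact: (Hb'.2 W _ bil).1.
  split=> [f a x x'|x a f f'].
    rewrite -Hom; congr om; apply/funext => i.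
    by rewrite Hio -[LHS]/((a * io x i + io x' i) *: s f) scalerDl -scalerA.
  rewrite -Hom (omE _ _ (a *: s f + s f')) //; last by rewrite Hq !sE.
  congr om; apply/funext => i.
  by rewrite scalerDr -[RHS]/(a *: (io x i *: s f) + io x i *: s f') !scalerA mulrC.
pose del i : 'I_n -> R^o := fun j => (j == i)%:R.
have ioE (d : 'I_n -> R^o) : d = \sum_i d i *: del i.
  apply/funext => j; rewrite fct_sumE (bigD1 j) //= big1 => [|i /negbTE ij].
    by rewrite addr0 -[RHS]/(d j * del j j) /del eqxx mulr1.
  by rewrite -[LHS]/(d i * del i j) /del eq_sym ij mulr0.
(* [th] is the tensor in [A (x) F] represented by [y]. Its image in [R^n (x) F] has the coordinates
   [q (y i) = 0], so flatness gives [th = 0], and [k th] is the class of [y]. *)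
have [th [h_th k_th]] : exists th, h th = \sum_i b (del i) (q (y i)) /\ k th = om y.
  apply: (Hy (fun y => exists th, h th = \sum_i b (del i) (q (y i)) /\ k th = om y)).
    split=> [|a y1 y2 [t1 [h1 k1]] [t2 [h2 k2]]].
      exists 0; rewrite (lin0 Hh) (lin0 Hk) (lin0 Hom); split=> //.
      rewrite big1 // => i _; rewrite -[X in q X]/(0 : Q) (lin0 Hq).
      exact: (lin0 (Hb.1.2 _)).
    exists (a *: t1 + t2); rewrite Hh Hk Hom h1 h2 k1 k2; split=> //.
    rewrite scaler_sumr -big_split; apply: eq_bigr => i _.
    by rewrite -[LHS](Hb.1.2 _) -Hq.
  move=> _ [d [x [Ad ->]]]; have [d' d'E] := (io_im d).1 Ad.
  exists (b' d' (q x)); rewrite hE kE d'E; split; last by apply: omE; rewrite ?sE.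
  rewrite {1}[d]ioE (lin_sum (Hb.1.1 _)); apply: eq_bigr => i _.
  by rewrite (linZ (Hb.1.1 _)) (linZ Hq) (linZ (Hb.1.2 _)).
apply/omk; rewrite -k_th; suff -> : th = 0 by exact: lin0.
apply: hinj; rewrite lin0 // h_th big1 // => i _.
by rewrite qy (lin0 (Hb.1.2 _)).
Qed.

Variable I : R -> Prop.
Hypothesis HI : ideal I.

(** The case [n = 1], [A = I]: the intersection of [IQ] with [ker q] is [I] times [ker q]. For free
    [Q] this is the vanishing of [Tor_1(R/I, F)]. *)
Lemma flat_ideal y : ideal_times I y -> q y = 0 ->
  lspan (fun z => exists a x, I a /\ q x = 0 /\ z = a *: x) y.
Proof.
move=> Iy qy; have HA : submodule (fun d : 'I_1 -> R^o => I (d ord0)).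
  case: HI => [I0 [ID IM]]; split=> // a x z Ix Iz.
  by apply: ID => //; apply: IM.
have := @flat_lspan 1 _ (fun _ => y) HA.
have H1 : lspan (fun z : 'I_1 -> Q => exists d x, I (d ord0) /\ z = (fun i => d i *: x))
    (fun _ => y).
  have Hc : is_linear ((fun x _ => x) : Q -> 'I_1 -> Q) by [].
  apply: (lspan_map Hc) ((ideal_timesP _ _).1 Iy) => _ [a [x [Ia ->]]].
  by apply: lspan_gen; exists (fun _ => a), x.
move=> /(_ H1 (fun _ => qy)).
have He : is_linear ((fun f => f ord0) : ('I_1 -> Q) -> Q) by [].
apply: (lspan_map He) => _ [d [x [Id [qx ->]]]].
by apply: lspan_gen; exists (d ord0), x.
Qed.

Variables (L : lmodType R) (io : L -> Q).
Hypotheses (Hio : is_linear io) (io_inj : injective io)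
  (io_im : forall x, q x = 0 <-> exists l, io l = x).

Lemma flat_ker_ideal l : ideal_times I (io l) -> ideal_times I l.
Proof.
move=> Il; have ql : q (io l) = 0 by apply/io_im; exists l.
have /(_ (fun x => exists l', io l' = x /\ ideal_times I l')) := flat_ideal Il ql.
case=> [|_ [a [_ [Ia [/io_im [l' <-] ->]]]]|l' [/io_inj -> //]].
  split=> [|a _ _ [x [<- Ix]] [z [<- Iz]]].
    by exists 0; rewrite lin0 //; split=> //; exact: (sub0 (it_sub _ _)).
  by exists (a *: x + z); rewrite Hio; split=> //; case: (it_sub I L) => _; apply.
by exists (a *: l'); rewrite linZ //; split=> //; exact: it_gen.
Qed.

(** [L] is itself flat, as a syzygy of a flat module, so the conclusion of [flat_ideal] passes to
    [B -> L]. The relation between the [be (c i)] is trivial in [Q] by the equational criterion, and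
    [flat_lspan] makes it trivial inside [L]. Lifting it gives [e i] over the same elements with
    [\sum_i a i *: e i = 0], so that [b] is the combination of the [c i - e i], which lie in
    [ker be]. *)
Lemma flat_syzygy (HQ : eq_flat Q) (B : lmodType R) (be : B -> L) : is_linear be ->
  (forall l, exists b, be b = l) -> forall b, ideal_times I b -> be b = 0 ->
  lspan (fun z => exists a x, I a /\ be x = 0 /\ z = a *: x) b.
Proof.
move=> Hbe bes b [s [Is bE]] beb.
pose n := size s; pose a i := (tnth (in_tuple s) i).1.
pose c i := (tnth (in_tuple s) i).2.
have {}bE : b = \sum_(i < n) a i *: c i by rewrite bE big_tnth.
have Ia i : I (a i) by apply: Is; exact: mem_tnth.
have H0 : \sum_i a i *: io (be (c i)) = 0.
  transitivity (io (be b)); last by rewrite beb lin0.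
  by rewrite bE !lin_sum //; apply: eq_bigr => i _; rewrite !linZ.
have HA : submodule (fun d : 'I_n -> R^o => \sum_i a i * d i = 0).
  split=> [|r x z Hx Hz]; first by rewrite big1 // => i _; rewrite mulr0.
  transitivity (r * (\sum_i a i * x i) + \sum_i a i * z i).
    by rewrite mulr_sumr -big_split; apply: eq_bigr => i _ /=; rewrite mulrDr mulrCA.
  by rewrite Hx Hz mulr0 addr0.
have := flat_lspan HA (HQ _ _ _ H0) (fun i => (io_im _).2 (ex_intro _ _ erefl)).
move=> /(_ (fun y => exists e : 'I_n -> B,
  (forall i, io (be (e i)) = y i) /\ \sum_i a i *: e i = 0)).
case=> [|_ [d [_ [Ad [/io_im [l <-] ->]]]]|e [eE e0]].
- split=> [|r x z [e1 [E1 S1]] [e2 [E2 S2]]].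
    exists (fun _ => 0); split=> [i|]; first by rewrite (lin0 Hbe) (lin0 Hio).
    by rewrite big1 // => i _; rewrite scaler0.
  exists (fun i => r *: e1 i + e2 i); split=> [i|]; first by rewrite Hbe Hio E1 E2.
  transitivity (r *: (\sum_i a i *: e1 i) + \sum_i a i *: e2 i).
    rewrite scaler_sumr -big_split; apply: eq_bigr => i _ /=.
    by rewrite scalerDr !scalerA mulrC.
  by rewrite S1 S2 scaler0 addr0.
- have [b0 <-] := bes l; exists (fun i => d i *: b0).
  split=> [i|]; first by rewrite !linZ.
  by under eq_bigr do rewrite scalerA; rewrite -scaler_suml Ad scale0r.
have -> : b = \sum_i a i *: (c i - e i).
  by under eq_bigr do rewrite scalerBr; rewrite sumrB e0 subr0.
apply: sub_big => [|i _]; first exact: lspan_sub.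
apply: lspan_gen; exists (a i), (c i - e i); split=> //; split=> //.
by apply: io_inj; rewrite !linB // eE subrr lin0.
Qed.
End Flat.

(** * Triangular endomorphisms of free modules *)

Lemma it_killed (R : comPzRingType) (I : R -> Prop) (D : lmodType R) :
  (forall a (d : D), I a -> a *: d = 0) -> forall d : D, ideal_times I d -> d = 0.
Proof. by move=> H; apply: it_ind => [|a z /H//]; exact: (ker_sub lin_id). Qed.

Section Telescopic.
Variables (R : comPzRingType) (Y : Type) (lt : Y -> Y -> Prop).
Hypothesis wo : Defs.well_order lt.
Variables (Q : lmodType R) (e : Y * nat -> Q) (tau : Y -> nat -> R).
Hypothesis He : free_on e.

Definition below (y : Y) : Q -> Prop :=
  lspan (fun x => exists z n, lt z y /\ x = e (z, n)).

Variables (h : Y -> nat -> Q) (rho : Q -> Q).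
Hypotheses (Hh : forall y n, below y (h y n)) (Hrho : is_linear rho)
  (rhoE : forall y n, rho (e (y, n)) = e (y, n) - tau y n *: e (y, n.+1) - h y n).

Lemma below_ext (D : lmodType R) (f g : Q -> D) y : is_linear f -> is_linear g ->
  (forall z n, lt z y -> f (e (z, n)) = g (e (z, n))) ->
  forall x, below y x -> f x = g x.
Proof.
move=> Hf Hg H x Hx; apply/subr0_eq.
apply: (Hx _ (ker_sub (lin_sub Hf Hg))) => _ [z [n [zy ->]]].
by rewrite H // subrr.
Qed.

(** Well-founded recursion on [y]: since [h y n] lies below [y], its image is known before the
    values at [e (y, n)] are chosen. [S] is the problem posed at stage [y] by these images. *)
Lemma recursive_map (D : lmodType R) (S : Y -> (nat -> D) -> (nat -> D) -> Prop) :
  (forall y v, exists x, S y v x) ->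
  exists psi : Q -> D, is_linear psi /\
    forall y, S y (fun n => psi (h y n)) (fun n => psi (e (y, n))).
Proof.
move=> HS; have [ext extP] := choice (fun g => He.1 D g).
have [step stepP] := choice (fun yv : Y * (nat -> D) => HS yv.1 yv.2).
(* Generators at or above [y] get the dummy value 0, so that [ext] yields a linear map on all of
   [Q]; its value at [h y n] does not depend on them. *)
pose F y (rec : forall z, lt z y -> nat -> D) : nat -> D :=
  step (y, fun n => ext (fun zk => match pselect (lt zk.1 y) with
    | left H => rec zk.1 H zk.2 | right _ => 0 end) (h y n)).
have wf := wo.2.2.
pose val := Fix wf (fun _ => nat -> D) F.
have valE y : val y = F y (fun z _ => val z).
  apply: (Fix_eq wf) => x f g fg; rewrite /F; congr (step (x, _)); apply/funext => n.
  congr (ext _ _); apply/funext => zk; case: pselect => // H; by rewrite fg.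
exists (ext (fun zk => val zk.1 zk.2)); split; first exact: (extP _).1.
move=> y; set psi := ext _.
have -> : (fun n => psi (e (y, n))) = val y.
  by apply/funext => n; rewrite /psi (extP _).2.
rewrite valE /F; set v := (X in step (y, X)).
suff -> : (fun n => psi (h y n)) = v by exact: (stepP (y, v)).
apply/funext => n; rewrite /v; set w := (X in _ = ext X _).
have [[Hp pE] [Hw wE]] := (extP (fun zk => val zk.1 zk.2), extP w).
refine (below_ext Hp Hw _ (@Hh y n)) => z k zy.
by rewrite pE wE /w /=; case: pselect.
Qed.

(** Eklof's lemma in this presentation: at stage [y] the values on the [e (y, n)] must solve a
    [tau y]-system whose right-hand side involves only earlier values. *)
Lemma extend_along_rho (D : lmodType R) (phi : Q -> D) :
  (forall y, solvable_for (tau y) D) -> is_linear phi ->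
  exists psi : Q -> D, is_linear psi /\ forall x, psi (rho x) = phi x.
Proof.
move=> HD Hphi.
have [|psi [Hpsi psiE]] := @recursive_map D (fun y v x =>
    system (tau y) (fun n => v n + phi (e (y, n))) x).
  by move=> y v; exact: HD.
exists psi; split=> //; apply: (lin_ext He) => // [|[y n]]; first exact: lin_comp.
have := psiE y n => /= E; rewrite rhoE !(linB Hpsi) (linZ Hpsi) E; lmod.
Qed.

Variable I : R -> Prop.
Hypothesis HI : ideal I.

(** Tested against the germs of sequences in [Q/IQ], where all systems are solvable: the map to
    constant germs extends along [rho], hence kills [c], and a constant germ is zero only if its
    value is. *)
Lemma rho_inj_mod c : ideal_times I (rho c) -> ideal_times I c.
Proof.
move=> Ic; have [W [om [Hom [oms omk]]]] := quotient_exists (it_sub I Q).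
have [D [germ [Hg [gs [gk gsol]]]]] := germ_exists W.
have killed a (d : D) : I a -> a *: d = 0.
  move=> Ia; have [f <-] := gs d; rewrite -(linZ Hg); apply/gk; exists 0%N => k _.
  by have [x xE] := oms (f k); rewrite -[LHS]/(a *: f k) -xE -(linZ Hom); apply/omk/it_gen.
have [||psi [Hpsi psiE]] := @extend_along_rho D (fun x => germ (fun _ => om x)).
- by move=> y; exact: gsol.
- by move=> a x y; rewrite -Hg Hom.
have : germ (fun _ => om c) = 0 by rewrite -psiE; apply: (it_killed killed); exact: it_lin.
by move=> /gk [N /(_ N (leqnn N)) /omk].
Qed.

Lemma rho_torsion r y n x' c : below y x' ->
  ideal_times I (r *: e (y, n) + x' - rho c) -> exists k, I (r * tseg (tau y) n k).
Proof.
move=> Hx' Hc.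
have Isub : submodule (I : R^o -> Prop).
  by case: HI => I0 [ID IM]; split=> // a x z Ix Iz; apply: ID => //; apply: IM.
have [W [om [Hom [oms omk]]]] := quotient_exists Isub.
have [D [germ [Hg [gs [gk gsol]]]]] := germ_exists W.
have killed a (d : D) : I a -> a *: d = 0.
  move=> Ia; have [f <-] := gs d; rewrite -(linZ Hg); apply/gk; exists 0%N => k _.
  have [x xE] := oms (f k); rewrite -[LHS]/(a *: f k) -xE -(linZ Hom); apply/omk.
  by rewrite /GRing.scale /= mulrC; apply: HI.2.2.
(* A copy of the telescope of [tau y] over [R/I] inside the germs: at place [k], [ga m] is the
   scalar that leads from stage [m] to stage [k]. *)
pose ga m := germ (fun k => om (tseg (tau y) m (k - m))).
have gaE m : ga m - tau y m *: ga m.+1 = 0.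
  rewrite /ga -(linZ Hg) -(linB Hg); apply/gk; exists m.+1 => k mk.
  rewrite -[LHS]/(om (tseg (tau y) m (k - m)) - tau y m *: om (tseg (tau y) m.+1 (k - m.+1))).
  by rewrite -(subnSK mk) tsegS -(linZ Hom) subrr.
(* [psi] is zero below [y] and equals [ga] at [y]; above [y] it solves the systems that make it
   vanish on the image of [rho]. So it detects exactly the coefficient at level [y]. *)
have [|psi [Hpsi psiE]] := @recursive_map D (fun z v x =>
    [/\ lt z y -> forall m, x m = 0, z = y -> x = ga & lt y z -> system (tau z) v x]).
  move=> z v; have irr := wo_irr wo; case: wo => tr [tot _].
  case: (tot z y) => [->|[zy|yz]].
  - by exists ga; split=> // /irr.
  - exists (fun _ => 0); split=> // [zE|yz]; first by case: (irr y); rewrite -{1}zE.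
    by case: (irr y); exact: tr yz zy.
  - have [x Hx] := gsol (tau z) v; exists x; split=> // [zy|zE].
      by case: (irr y); exact: tr yz zy.
    by case: (irr y); rewrite -{2}zE.
have psi0 x : below y x -> psi x = 0.
  move=> Hx; apply: (below_ext Hpsi lin_zero _ Hx) => z m zy.
  by have [H _ _] := psiE z; exact: H.
have psi_rho x : psi (rho x) = 0.
  move: x; apply: (lin_ext He (g := fun _ => 0)); [exact: lin_comp | exact: lin_zero|].
  move=> [z m]; rewrite rhoE !(linB Hpsi) (linZ Hpsi); have [H1 H2 H3] := psiE z.
  case: wo => tr [tot _].
  case: (tot z y) => [zE|[zy|yz]].
  - have -> := psi0 (h z m); last by rewrite -zE; exact: @Hh.
    have H k : psi (e (z, k)) = ga k by rewrite -(H2 zE).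
    by rewrite !H subr0 zE gaE.
  - rewrite !H1 // (psi0 (h z m)); first by lmod.
    apply: (lspan_mono _ (@Hh z m)) => _ [w [k [wz ->]]].
    by exists w, k; split=> //; exact: tr wz zy.
  - by rewrite (H3 yz m) subrr.
have := it_killed killed (it_lin Hpsi Hc).
rewrite (linB Hpsi) (linD Hpsi) (linZ Hpsi) psi_rho (psi0 _ Hx') subr0 addr0.
have [_ /(_ erefl) E _] := psiE y; have -> : psi (e (y, n)) = ga n by rewrite -E.
rewrite /ga -(linZ Hg) => /gk [N /(_ (N + n)%N (leq_addr _ _))].
rewrite -[X in X = _ -> _]/(r *: om (tseg (tau y) n (N + n - n))) -(linZ Hom) => /omk.
by rewrite addnK => H; exists N.
Qed.

Section Kernel.
Variables (R' : comPzRingType) (pi : {rmorphism R -> R'}) (G : lmodType R').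
Variables (g : Y -> nat -> G) (ev : Q -> G).
Hypotheses (evL : semilinear pi ev) (evE : forall y n, ev (e (y, n)) = g y n).
Hypothesis I_pi : forall r, I r <-> pi r = 0.
Hypothesis g_tors : forall y n r' x, below y x -> r' *: g y n = ev x ->
  exists k, r' * pi (tseg (tau y) n k) = 0.
Hypothesis ev_rho : forall x, ev (rho x) = 0.

Definition imI (x : Q) : Prop := exists c, ideal_times I (x - rho c).

Lemma imI_sub : submodule imI.
Proof.
split=> [|a x z [c Hc] [d Hd]].
  by exists 0; rewrite (lin0 Hrho) subrr; exact: (sub0 (it_sub _ _)).
exists (a *: c + d); rewrite Hrho.
have -> : a *: x + z - (a *: rho c + rho d) = a *: (x - rho c) + (z - rho d) by lmod.
by case: (it_sub I Q) => _; apply.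
Qed.

Lemma imI_shift y n k : exists x, below y x /\
  imI (e (y, n) - tseg (tau y) n k *: e (y, (n + k)%N) - x).
Proof.
elim: k => [|k [x [Hx Hk]]].
  exists 0; split; first exact: (sub0 (lspan_sub _)).
  by rewrite tseg0 scale1r addn0 subrr subr0; exact: (sub0 imI_sub).
exists (x + tseg (tau y) n k *: h y (n + k)%N); split.
  by apply: (subD (lspan_sub _)) => //; apply: (subZ (lspan_sub _)); exact: @Hh.
have Hr : imI (rho (e (y, (n + k)%N))).
  by exists (e (y, (n + k)%N)); rewrite subrr; exact: (sub0 (it_sub _ _)).
have := subD imI_sub Hk (subZ imI_sub (tseg (tau y) n k) Hr); congr imI.
by rewrite rhoE tsegSr addnS; lmod.
Qed.

(** Modulo [imI] the generators of level [z] form a telescope, so the whole component of [x] at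
    level [z] can be put on one generator [e (z, n)], with [n] as large as desired. *)
Definition toplevel (z : Y) (x : Q) : Prop :=
  exists n r x', below z x' /\ imI (x - (r *: e (z, n) + x')).

Lemma toplevel_raise z x : toplevel z x -> forall N, exists n r x',
  (N <= n)%N /\ below z x' /\ imI (x - (r *: e (z, n) + x')).
Proof.
move=> [n [r [x' [Hx' Hx]]]] N; have [w [Hw Hk]] := imI_shift z n N.
exists (n + N)%N, (r * tseg (tau z) n N), (x' + r *: w); split; first exact: leq_addl.
split; first by apply: (subD (lspan_sub _)) => //; apply: (subZ (lspan_sub _)).
by have := subD imI_sub Hx (subZ imI_sub r Hk); congr imI; lmod.
Qed.

Lemma toplevel_sub z : submodule (toplevel z).
Proof.
split=> [|a x1 x2 H1 H2].
  exists 0%N, 0, 0; split; first exact: (sub0 (lspan_sub _)).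
  by rewrite scale0r addr0 subrr; exact: (sub0 imI_sub).
have [n1 [r1 [y1 [_ [B1 I1]]]]] := toplevel_raise H1 0.
have [n [r2 [y2 [le12 [B2 I2]]]]] := toplevel_raise H2 n1.
have [w [Hw Hk]] := imI_shift z n1 (n - n1); rewrite subnKC // in Hk.
exists n, (a * (r1 * tseg (tau z) n1 (n - n1)) + r2), (a *: (y1 + r1 *: w) + y2); split.
  apply: (subD (lspan_sub _)) => //; apply: (subZ (lspan_sub _)).
  by apply: (subD (lspan_sub _)) => //; apply: (subZ (lspan_sub _)).
have := subD imI_sub (subD imI_sub (subZ imI_sub a I1) I2)
  (subZ imI_sub (a * r1) Hk); congr imI; lmod.
Qed.

Lemma toplevel_mono z y x : lt z y -> toplevel z x -> toplevel y x.
Proof.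
move=> zy [n [r [x' [Hx' Hx]]]]; exists 0%N, 0, (r *: e (z, n) + x'); split.
  apply: (subD (lspan_sub _)).
    by apply: (subZ (lspan_sub _)); apply: lspan_gen; exists z, n.
  apply: (lspan_mono _ Hx') => _ [w [k [wz ->]]]; exists w, k; split=> //.
  by case: wo => tr _; exact: tr wz zy.
by rewrite scale0r add0r.
Qed.

Lemma toplevel_union (P : Y -> Prop) : submodule (fun x =>
  imI x \/ exists z, P z /\ toplevel z x).
Proof.
split=> [|a x1 x2 H1 H2]; first by left; exact: (sub0 imI_sub).
have imI_top z x : imI x -> toplevel z x.
  move=> Hx; exists 0%N, 0, 0; rewrite scale0r addr0 subr0; split=> //.
  exact: (sub0 (lspan_sub _)).
case: H1 => [H1|[z1 [P1 H1]]]; case: H2 => [H2|[z2 [P2 H2]]].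
- by left; case: imI_sub => _; apply.
- by right; exists z2; split=> //; case: (toplevel_sub z2) => _; apply=> //; exact: imI_top.
- by right; exists z1; split=> //; case: (toplevel_sub z1) => _; apply=> //; exact: imI_top.
right; case: wo => _ [tot _]; case: (tot z1 z2) => [E|[z12|z21]].
- by exists z2; split=> //; case: (toplevel_sub z2) => _; apply=> //; rewrite -E.
- exists z2; split=> //; case: (toplevel_sub z2) => _; apply=> //.
  exact: toplevel_mono z12 H1.
- exists z1; split=> //; case: (toplevel_sub z1) => _; apply=> //.
  exact: toplevel_mono z21 H2.
Qed.

Lemma toplevel_gen z n : toplevel z (e (z, n)).
Proof.
exists n, 1, 0; split; first exact: (sub0 (lspan_sub _)).
by rewrite scale1r addr0 subrr; exact: (sub0 imI_sub).
Qed.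

Lemma ev_sub : submodule (fun x => ev x = 0).
Proof.
case: evL => evD evZ; split=> [|a x z Ex Ez].
  by rewrite -(scale0r (0 : Q)) evZ rmorph0 scale0r.
by rewrite evD evZ Ex Ez scaler0 addr0.
Qed.

Lemma ev_imI x : imI x -> ev x = 0.
Proof.
case: evL => evD evZ [c Hc]; rewrite -(subrK (rho c) x) evD ev_rho addr0.
apply: (it_ind ev_sub _ Hc) => a z /I_pi Ia.
by rewrite evZ Ia scale0r.
Qed.

(** Well-founded descent on the top level. If [ev x = 0], then [pi r] times [g z n] comes from below
    [z], so [g_tors] puts [r * tseg (tau z) n k] into [I]; moving the top term from index [n] to
    [n + k] therefore removes it modulo [imI], and the rest has a lower top level. *)
Lemma ker_ev x : ev x = 0 -> imI x.
Proof.
have key z : forall x, toplevel z x -> ev x = 0 -> imI x.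
  elim: {z}(wo.2.2 z) => z _ IH {}x [n [r [x' [Hx' Hx]]]] Ex.
  have E1 : ev (r *: e (z, n) + x') = 0.
    have /eqP := ev_imI Hx; case: evL => evD evZ.
    rewrite -scaleN1r evD evZ Ex add0r rmorphN1 scaleN1r oppr_eq0.
    by move/eqP.
  have E2 : pi r *: g z n = ev ((-1) *: x').
    case: evL => evD evZ; rewrite evD !evZ evE in E1; rewrite evZ rmorphN1 scaleN1r.
    by apply/eqP; rewrite -addr_eq0 E1.
  have [|k Hk] := g_tors _ E2; first by apply: (subZ (lspan_sub _)).
  rewrite -rmorphM in Hk; move/I_pi: Hk => Hk.
  have [w [Hw Hsh]] := imI_shift z n k.
  have Hx2 : imI (x - (x' + r *: w)).
    have Hr : imI ((r * tseg (tau z) n k) *: e (z, (n + k)%N)).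
      by exists 0; rewrite (lin0 Hrho) subr0; exact: it_gen.
    have := subD imI_sub (subD imI_sub Hx (subZ imI_sub r Hsh)) Hr.
    by congr imI; lmod.
  have Hb : below z (x' + r *: w).
    by apply: (subD (lspan_sub _)) => //; apply: (subZ (lspan_sub _)).
  apply: (sub_eq imI_sub Hx2).
  have Eb : ev (x' + r *: w) = 0.
    have := subB ev_sub Ex (ev_imI Hx2); congr (ev _ = 0); lmod.
  have [||[u [uz Hu]]] := Hb _ (toplevel_union (fun u => lt u z)); last exact: IH Hu Eb.
    by move=> _ [u [k' [uz ->]]]; right; exists u; split=> //; exact: toplevel_gen.
  by [].
have [//|[z [_ Hz]]] : imI x \/ exists z, True /\ toplevel z x.
  move: x; apply: He.2; first exact: toplevel_union.
  by move=> [z n]; right; exists z; split=> //; exact: toplevel_gen.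
exact: key Hz.
Qed.
End Kernel.
End Telescopic.

(** * Transfinite extensions as telescopes *)

Section Monoid.
Variable R : comPzRingType.
Implicit Types e t : nat -> R.

(** Partial products rather than the generators themselves: [e i] divides every [tel e n] with
    [n >= i], so each generator is inverted infinitely often along the telescope. *)
Definition tel e n : R := \prod_(i < n.+1) e i.
Definition mon e (s : R) : Prop := exists w : seq nat, s = \prod_(i <- w) e i.

Lemma mon1 e : mon e 1. Proof. by exists [::]; rewrite big_nil. Qed.
Lemma monM e s s' : mon e s -> mon e s' -> mon e (s * s').
Proof. by move=> [w ->] [w' ->]; exists (w ++ w'); rewrite big_cat. Qed.
Lemma mon_prod e (J : Type) (r : seq J) (f : J -> R) :
  (forall j, mon e (f j)) -> mon e (\prod_(j <- r) f j).
Proof. by move=> H; apply: (big_ind (mon e)) => //; [exact: mon1 | exact: monM]. Qed.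
Lemma mon_tel e n : mon e (tel e n).
Proof. by apply: mon_prod => i; exists [:: nat_of_ord i]; rewrite big_seq1. Qed.
Lemma mon_tseg e n k : mon e (tseg (tel e) n k).
Proof. by apply: mon_prod => i; exact: mon_tel. Qed.

Lemma mon_countable e : countable_mult_subset (mon e).
Proof.
split; first exact: mon1; split; first by move=> s s'; exact: monM.
exists (fun n => \prod_(i <- odflt [::] (unpickle n)) e i) => _ [w ->].
by exists (pickle w); rewrite pickleK.
Qed.

Lemma countable_mon (S : R -> Prop) : countable_mult_subset S ->
  exists e, S = mon e.
Proof.
(* The enumeration may take values outside [S]; these are replaced by 1. *)
move=> [S1 [SM [f Hf]]]; pose e n := if pselect (S (f n)) then f n else 1.
have Se n : S (e n) by rewrite /e; case: pselect.
exists e; apply/funext => s; apply/propext; split=> [Ss|[w ->]]; last first.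
  by elim: w => [|i w IH]; rewrite ?big_nil // big_cons; apply: SM.
have [n fn] := Hf _ Ss; exists [:: n]; rewrite big_seq1 /e fn.
by case: pselect.
Qed.

Lemma tel_dvd e i m : (i <= m)%N -> exists u, tel e m = e i * u.
Proof.
rewrite -ltnS => im; exists (\prod_(j < m.+1 | j != Ordinal im) e j).
by rewrite /tel (bigD1 (Ordinal im)).
Qed.

Lemma mon_dvd e s : mon e s -> forall n, exists k u, tseg (tel e) n k = s * u.
Proof.
move=> [w ->]; elim: w => [|i w IH] n.
  by exists 0%N, 1; rewrite tseg0 big_nil mulr1.
have [k [u E]] := IH n; have [|v Ev] := @tel_dvd e i (n + k + i)%N.
  exact: leq_addl.
exists (k + i.+1)%N, (u * (tseg (tel e) (n + k) i * v)).
rewrite tsegD tsegSr Ev E big_cons.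
set p := \prod_(_ <- _) _; set q := tseg _ _ _; ring.
Qed.

(** An intrinsic description of the colimit of [R --t 0--> R --t 1--> ...]: [c n] is the image of
    the unit at stage [n], and an element dies in the colimit only if it dies at a finite stage. *)
Definition telescope_of t (C : lmodType R) (c : nat -> C) : Prop :=
  [/\ forall n, c n = t n *: c n.+1, forall x, exists r n, x = r *: c n &
      forall r n, r *: c n = 0 -> exists k, r * tseg t n k = 0].

Lemma telescope_shift t (C : lmodType R) (c : nat -> C) : telescope_of t c ->
  forall n k, c n = tseg t n k *: c (n + k)%N.
Proof.
move=> [H _ _] n; elim=> [|k IH]; first by rewrite tseg0 scale1r addn0.
by rewrite IH H scalerA tsegSr addnS.
Qed.

Lemma loc_telescope e (C : lmodType R) : iso_to_loc (mon e) C ->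
  exists c, telescope_of (tel e) (c : nat -> C).
Proof.
move=> [q [qs [qe [qD qZ]]]]; pose s n := tseg (tel e) 0 n.
have Ms n : mon e (s n) by exact: mon_tseg.
have M1 := mon1 e.
exists (fun n => q 1 (s n)); split=> [n|x|r n].
- rewrite qZ // mulr1; apply/qe => //; exists 1; split=> //.
  by rewrite /s tsegSr add0n; ring.
- have [r [s' [Ms' <-]]] := qs x; have [k [u E]] := mon_dvd Ms' 0.
  exists (r * u), k; rewrite qZ //; apply/qe => //; exists 1; split=> //.
  by rewrite /s E; ring.
- rewrite qZ // mulr1 => H.
  have q0 : q 0 1 = 0 by rewrite -{1}(mul0r 1) -qZ // scale0r.
  have [t [Mt Ht]] : exists t : R, mon e t /\ t * (r * 1 - 0 * s n) = 0.
    by apply/qe => //; rewrite H q0.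
  have [k [u E]] := mon_dvd Mt n; exists k.
  rewrite E -[RHS](mul0r u) -Ht; ring.
Qed.

(** Each [s] in the monoid divides a segment of transition scalars, which makes it act injectively
    and makes [r *: c 0] divisible by it; the fraction [r / s] is the unique [x] with
    [s *: x = r *: c 0]. *)
Lemma telescope_loc e (C : lmodType R) (c : nat -> C) :
  telescope_of (tel e) c -> iso_to_loc (mon e) C.
Proof.
move=> Hc; have sh := telescope_shift Hc; case: (Hc) => [_ gen tors].
have uniq s (x : C) : mon e s -> s *: x = 0 -> x = 0.
  move=> Ms; have [r [n ->]] := gen x; rewrite scalerA => /tors [k E].
  have [l [u El]] := mon_dvd Ms (n + k).
  rewrite (sh n (k + l)%N) scalerA tsegD El.
  set p := tseg _ _ _ in E *; have -> : r * (p * (s * u)) = s * r * p * u by ring.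
  by rewrite E mul0r scale0r.
have ex s r : exists x, mon e s -> s *: x = r *: c 0%N.
  have [Ms|nM] := EM (mon e s); last by exists 0.
  have [k [u E]] := mon_dvd Ms 0; exists ((r * u) *: c k) => _.
  by rewrite (sh 0%N k) E !scalerA add0n; congr (_ *: _); ring.
have /choice [q qE] : forall rs : R * R, exists x, mon e rs.2 -> rs.2 *: x = rs.1 *: c 0%N.
  by move=> [r s]; exact: ex.
have {}qE r s : mon e s -> s *: q (r, s) = r *: c 0%N := qE (r, s).
have qP r s x : mon e s -> s *: x = r *: c 0%N -> x = q (r, s).
  move=> Ms E; apply/subr0_eq; apply: (uniq s) => //.
  by rewrite scalerBr E qE // subrr.
exists (fun r s => q (r, s)); split; [|split; [|split]].
- move=> x; have [r [n ->]] := gen x; exists r, (tseg (tel e) 0 n).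
  split; first exact: mon_tseg.
  apply/esym/qP; first exact: mon_tseg.
  by rewrite (sh 0%N n) add0n !scalerA mulrC.
- move=> r s r' s' Ms Ms'; split=> [E|[t [Mt Ht]]].
    have H : (r * s' - r' * s) *: c 0%N = 0.
      have -> : (r * s' - r' * s) *: c 0%N = s' *: (r *: c 0%N) - s *: (r' *: c 0%N) by lmod.
      by rewrite -(qE r s) // -(qE r' s') // E /=; lmod.
    by have [k Hk] := tors _ _ H; exists (tseg (tel e) 0 k); split;
      [exact: mon_tseg | rewrite mulrC].
  apply: qP => //; apply/subr0_eq; apply: (uniq (t * s)); first exact: monM.
  transitivity ((t * (r * s' - r' * s)) *: c 0%N); last by rewrite Ht scale0r.
  transitivity ((t * s') *: (s *: q (r, s)) - (t * s) *: (r' *: c 0%N)); first by lmod.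
  by rewrite (qE r s) //=; lmod.
- move=> r s r' s' Ms Ms'; apply: qP; first exact: monM.
  transitivity (s' *: (s *: q (r, s)) + s *: (s' *: q (r', s'))); first by lmod.
  by rewrite (qE r s) // (qE r' s') //=; lmod.
- move=> a r s Ms; apply: qP => //.
  transitivity (a *: (s *: q (r, s))); first by lmod.
  by rewrite (qE r s) //; lmod.
Qed.

Lemma tel_one n : tel (fun _ => 1) n = 1. Proof. exact: big1. Qed.

Lemma iso_R_telescope (C : lmodType R) : iso_to_R C ->
  exists c, telescope_of (tel (fun _ => 1)) (c : nat -> C).
Proof.
move=> [f [fL [g fg gf]]]; exists (fun _ => f 1).
have f0 : f 0 = 0.
  by have := fL (-1) 0 0; rewrite mulr0 addr0 scaleN1r addNr.
have fr r : r *: f 1 = f r by have := fL r 1 0; rewrite mulr1 !addr0 f0 addr0.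
split=> [n|x|r n].
- by rewrite tel_one scale1r.
- by exists (g x), 0%N; rewrite fr gf.
- rewrite fr -f0 => /(can_inj fg) ->; exists 0%N; exact: mul0r.
Qed.
End Monoid.

Section Telescoping.
Variables (R : comPzRingType) (A : Type) (e : A -> nat -> R).

Definition slt (G : lmodType R) (Y : Type) (lt : Y -> Y -> Prop)
  (g : Y -> nat -> G) (y : Y) : G -> Prop :=
  lspan (fun x => exists z n, lt z y /\ x = g z n).

(** Transfinite extensions by generators: modulo the span of the earlier ones, the [g y n] satisfy
    the conditions of [telescope_of]. The chain of submodules is implicit in these spans. *)
Definition tele_data (G : lmodType R) (Y : Type) (lt : Y -> Y -> Prop)
    (ty : Y -> A) (g : Y -> nat -> G) : Prop :=
  [/\ Defs.well_order lt,
      forall y n, slt lt g y (g y n - tel (e (ty y)) n *: g y n.+1),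
      forall y n r, slt lt g y (r *: g y n) -> exists k, r * tseg (tel (e (ty y))) n k = 0 &
      forall x, lspan (fun x => exists z n, x = g z n) x].

Definition telescoping (G : lmodType R) : Prop :=
  exists Y lt ty g, @tele_data G Y lt ty g.

Lemma transfinite_telescoping (G : lmodType R) (P : lmodType R -> Prop) :
  (forall C, P C -> exists a c, telescope_of (tel (e a)) (c : nat -> C)) ->
  transfinite_extension G P -> telescoping G.
Proof.
move=> HP [O [lt [sg [M [wo [top [Msub [mono [bot [full [lim succ]]]]]]]]]]].
have irr := wo_irr wo; have [tr [tot wf]] := wo.
(* The elements before the top are those that have a successor, hence the steps of the extension. *)
pose Y := {a : O | lt a sg}.
have suc (y : Y) : exists (s : A * O * (nat -> G)),
    let: (a, b, gs) := s in
    [/\ lt (sval y) b /\ (forall c, lt (sval y) c -> c = b \/ lt b c),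
        forall n, M b (gs n),
        forall n, M (sval y) (gs n - tel (e a) n *: gs n.+1),
        forall r n, M (sval y) (r *: gs n) -> exists k, r * tseg (tel (e a)) n k = 0 &
        forall x, M b x -> exists r n, M (sval y) (x - r *: gs n)].
  case: y => y ysg /=.
  have [b [yb bmin]] := wo_min (A := fun c => lt y c) wo ysg.
  have [C [PC [f [fL [fs fk]]]]] := succ y b yb bmin.
  have [a [c [cS cG cT]]] := HP C PC.
  have [gs gsP] := choice (fun n => fs (c n)).
  have Mb n : M b (gs n) by case: (gsP n).
  have fgs n : f (gs n) = c n by case: (gsP n).
  have fB x z r : M b x -> M b z -> f (x - r *: z) = f x - r *: f z.
    move=> Mx Mz; have -> : x - r *: z = (- r) *: z + x by lmod.
    by rewrite fL //; lmod.
  have MB x z r : M b x -> M b z -> M b (x - r *: z).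
    by move=> Mx Mz; apply: (subB (Msub b)) => //; apply: (subZ (Msub b)).
  exists (a, b, gs); split=> // [n|r n Mr|x Mx].
  - by apply/fk; [exact: MB | rewrite fB // !fgs cS subrr].
  - apply: cT; rewrite -fgs.
    have := (fk _ (subZ (Msub b) r (Mb n))).2 Mr; have := fL r (gs n) 0 (Mb n) (sub0 (Msub b)).
    have f0 : f 0 = 0 by apply/fk => //; exact: sub0.
    by rewrite f0 !addr0 => ->.
  - have [r [n E]] := cG (f x); exists r, n.
    by apply/fk; [exact: MB | rewrite fB // fgs E subrr].
have [S SP] := choice suc.
pose ty y := (S y).1.1; pose nx y := (S y).1.2; pose g y := (S y).2.
have {}SP y : [/\ lt (sval y) (nx y) /\ (forall c, lt (sval y) c -> c = nx y \/ lt (nx y) c),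
        forall n, M (nx y) (g y n),
        forall n, M (sval y) (g y n - tel (e (ty y)) n *: g y n.+1),
        forall r n, M (sval y) (r *: g y n) -> exists k, r * tseg (tel (e (ty y))) n k = 0 &
        forall x, M (nx y) x -> exists r n, M (sval y) (x - r *: g y n)].
  by move: (SP y); rewrite /ty /nx /g; case: (S y) => [[a b] gs].
pose Sp a := lspan (fun x => exists (z : Y) n, lt (sval z) a /\ x = g z n).
(* Transfinite induction: only the successor case brings in new generators. *)
have M_Sp a : forall x, M a x -> Sp a x.
  elim: {a}(wf a) => a _ IH x Mx.
  have Sp_mono b : lt b a -> forall z, Sp b z -> Sp a z.
    move=> ba z Hz; apply: (lspan_mono _ Hz) => _ [w [n [wb ->]]].
    by exists w, n; split=> //; exact: tr wb ba.
  have [exb|nob] := EM (exists b, lt b a); last first.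
    have nb b : ~ lt b a by move=> ba; apply: nob; exists b.
    rewrite ((bot a nb x).1 Mx); exact: (sub0 (lspan_sub _)).
  have [isl|nl] := EM (forall b, lt b a -> exists c, lt b c /\ lt c a).
    have [b [ba Mb]] := (lim a exb isl x).1 Mx.
    by apply: (Sp_mono b ba); exact: IH.
  have [b [ba nob]] : exists b, lt b a /\ forall c, ~ (lt b c /\ lt c a).
    apply: contrapT => H; apply: nl => b ba; apply: contrapT => H'; apply: H.
    by exists b; split=> // c Hc; apply: H'; exists c.
  have bsg : lt b sg by case: (top a) => [/(tr _ _ _ ba)|<-].
  pose y : Y := exist _ b bsg; have [[ynx nxm] _ _ _ Hx] := SP y.
  have nxa : nx y = a.
    case: (nxm a ba) => [//|na]; by case: (nob (nx y)).
  rewrite -nxa in Mx; have [r [n Mr]] := Hx _ Mx.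
  apply: (sub_eq (lspan_sub _) (y := r *: g y n)).
    by apply: (Sp_mono b ba); exact: IH.
  by apply: (subZ (lspan_sub _)); apply: lspan_gen; exists y, n.
pose ltY (y z : Y) := lt (sval y) (sval z).
have slt_M y x : slt ltY g y x -> M (sval y) x.
  move=> Hx; apply: (Hx _ (Msub _)) => _ [z [n [zy ->]]].
  have [[_ nxm] Mz _ _ _] := SP z.
  by case: (nxm _ zy) => [->//|H]; apply: mono H _ _.
have M_slt y x : M (sval y) x -> slt ltY g y x by exact: M_Sp.
exists Y, ltY, ty, g; split.
- split; first by move=> x y z; exact: tr.
  split.
    move=> [x Hx] [y Hy]; case: (tot x y) => [E|]; last by right.
    by left; subst y; congr exist; exact: Prop_irrelevance.
  move=> y; move: {2}(sval y) (erefl (sval y)) => a.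
  elim: {a}(wf a) y => a _ IH y E; constructor => z zy.
  by apply: (IH (sval z)) => //; rewrite -E.
- by move=> y n; apply: M_slt; have [_ _ H _ _] := SP y.
- by move=> y n r Hr; have [_ _ _ H _] := SP y; apply: H; exact: slt_M.
- move=> x; have := M_Sp sg x (full x).
  by apply: lspan_mono => _ [z [n [_ ->]]]; exists z, n.
Qed.

Lemma telescoping_transfinite (G : lmodType R) : telescoping G ->
  transfinite_extension G (fun C => exists a, iso_to_loc (mon (e a)) C).
Proof.
move=> [Y [lt [ty [g [wo gS gT gG]]]]]; have irr := wo_irr wo; have [tr [tot wf]] := wo.
(* [None] is a new greatest element. [M a] is spanned by the generators strictly before [a], which
   makes the chain zero at the bottom and continuous at limits. *)
pose ltO (a b : option Y) := match a, b with
  | Some x, Some y => lt x y | Some _, None => True | None, _ => False end.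
pose M (a : option Y) := lspan (fun x => exists z n, ltO (Some z) a /\ x = g z n).
have trO a b c : ltO a b -> ltO b c -> ltO a c.
  by case: a b c => [x|] [y|] [z|] //=; exact: tr.
have totO a b : a = b \/ ltO a b \/ ltO b a.
  case: a b => [x|] [y|]; [|by right; left|by right; right|by left].
  by case: (tot x y) => [->|]; [left | right].
have wfO : well_founded ltO.
  have accS y : Acc ltO (Some y).
    elim: (wf y) => {}y _ IH; apply: Acc_intro; case=> [z zy|H]; last by case: H.
    exact: IH.
  case=> [y|]; first exact: accS.
  by apply: Acc_intro; case=> [z _|H]; [exact: accS | case: H].
have M_mono a b : ltO a b -> forall x, M a x -> M b x.
  move=> ab x Hx; apply: (lspan_mono _ Hx) => _ [z [n [za ->]]].
  by exists z, n; split=> //; exact: trO za ab.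
exists (option Y), ltO, None, M.
split; first by split.
split; first by case=> [a|]; [left | right].
split; first by move=> a; exact: lspan_sub.
split; first exact: M_mono.
split.
  move=> a na x; split=> [Hx|->]; last exact: (sub0 (lspan_sub _)).
  by apply: (Hx _ (ker_sub lin_id)) => u [z [n [za _]]]; case: (na (Some z)).
split; first by move=> x; apply: (lspan_mono _ (gG x)) => _ [z [n ->]]; exists z, n.
have Msub a : submodule (M a) by exact: lspan_sub.
split.
  move=> a [b0 b0a] isl x; split=> [Hx|[b [ba Mb]]]; last exact: M_mono ba _ Mb.
  apply: (Hx (fun x => exists b, ltO b a /\ M b x)).
    split=> [|r x1 x2 [b1 [b1a M1]] [b2 [b2a M2]]].
      by exists b0; split=> //; exact: (sub0 (Msub b0)).
    case: (totO b1 b2) => [E|[b12|b21]].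
    + by subst b2; exists b1; split=> //; case: (Msub b1) => _; apply.
    + exists b2; split=> //; case: (Msub b2) => _; apply=> //.
      exact: M_mono b12 _ M1.
    + exists b1; split=> //; case: (Msub b1) => _; apply=> //.
      exact: M_mono b21 _ M2.
  move=> _ [z [n [za ->]]]; have [c [zc ca]] := isl _ za.
  by exists c; split=> //; apply: lspan_gen; exists z, n.
move=> [y|] // b yb bmin.
  have ltb z : ltO (Some z) b -> z = y \/ lt z y.
    move=> zb; case: (tot z y) => [|[|yz]]; [by left | by right|].
    have irrO c : ~ ltO c c by case: c => [c|] //; exact: irr.
    case: (bmin (Some z) yz) => [zE|bz]; first by case: (irrO b); rewrite -{1}zE.
    by case: (irrO b); exact: trO bz zb.
  have [H [ka [Hka [kas kak]]]] := quotient_exists (Msub (Some y)).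
  have imsub : submodule (fun u => exists x, M b x /\ ka x = u).
    split=> [|a _ _ [x [Mx <-]] [z [Mz <-]]].
      by exists 0; split; [exact: (sub0 (Msub b)) | exact: lin0].
    by exists (a *: x + z); split; [case: (Msub b) => _; apply | exact: Hka].
  have [C [io [Hio [ioi ioP]]]] := submodule_exists imsub.
  have /choice [f fP] : forall x, exists c : C, M b x -> io c = ka x.
    move=> x; have [Mx|nM] := EM (M b x); last by exists 0.
    by have [c cE] := (ioP (ka x)).1 (ex_intro _ x (conj Mx erefl)); exists c.
  have Mg n : M b (g y n) by apply: lspan_gen; exists y, n.
  exists C; split; last first.
    exists f; split.
      move=> a x z Mx Mz; have Mxz : M b (a *: x + z) by case: (Msub b) => _; apply.
      by apply: ioi; rewrite Hio (fP _ Mx) (fP _ Mz) (fP _ Mxz) Hka.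
    split=> [c|x Mx].
      have [x [Mx xE]] := (ioP (io c)).2 (ex_intro _ c erefl).
      by exists x; split=> //; apply: ioi; rewrite fP.
    split=> [fx|Mx'].
      by apply/kak; rewrite -fP // fx (lin0 Hio).
    by apply: ioi; rewrite fP // (lin0 Hio); apply/kak.
  exists (ty y); apply: (@telescope_loc _ _ _ (fun n => f (g y n))); split.
  - move=> n; apply: ioi; rewrite (linZ Hio) !fP //; apply/subr0_eq.
    rewrite -(linZ Hka) -(linB Hka); apply/kak; exact: gS.
  - move=> c; have [x [Mx xE]] := (ioP (io c)).2 (ex_intro _ c erefl).
    have {c xE} -> : c = f x by apply: ioi; rewrite fP.
    have [r [n Hx]] : exists r n, M (Some y) (x - r *: g y n).
      (* Modulo [M (Some y)] a multiple of [g y n] is one of [g y (n + N)], so two elements can be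
         compared on a common generator. *)
      have raise n r x0 N : M (Some y) (x0 - r *: g y n) -> exists r', M (Some y) (x0 - r' *: g y (n + N)%N).
        elim: N r => [|N IH] r H0; first by exists r; rewrite addn0.
        have [r' Hr'] := IH r H0; exists (r' * tel (e (ty y)) (n + N)%N).
        have := subD (Msub (Some y)) Hr' (subZ (Msub (Some y)) r' (gS y (n + N)%N)).
        by rewrite addnS; congr (M (Some y) _); lmod.
      apply: (Mx (fun x => exists r n, M (Some y) (x - r *: g y n))).
        split=> [|a x1 x2 [r1 [n1 H1]] [r2 [n2 H2]]].
          by exists 0, 0%N; rewrite scale0r subr0; exact: (sub0 (Msub (Some y))).
        have [s1 K1] := raise _ _ _ n2 H1; have [s2 K2] := raise _ _ _ n1 H2.
        rewrite addnC in K2; exists (a * s1 + s2), (n1 + n2)%N.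
        have := subD (Msub (Some y)) (subZ (Msub (Some y)) a K1) K2.
        by congr (M (Some y) _); lmod.
      move=> _ [z [n [zb ->]]]; case: (ltb _ zb) => [->|zy].
        by exists 1, n; rewrite scale1r subrr; exact: (sub0 (Msub (Some y))).
      by exists 0, 0%N; rewrite scale0r subr0; apply: lspan_gen; exists z, n.
    exists r, n; apply: ioi; rewrite (linZ Hio) !fP // -(linZ Hka); apply/subr0_eq.
    by rewrite -(linB Hka); apply/kak.
  - move=> r n E; apply: (gT y n r); apply/kak; rewrite (linZ Hka) -fP // -(linZ Hio) E.
    exact: lin0.
Qed.
End Telescoping.

(** * Projectivity of the syzygy *)

Section Core.
Variables (R : comPzRingType) (I : R -> Prop).
Hypotheses (HI : ideal I) (HT : T_nilpotent I).
Variables (F Q L : lmodType R) (q : Q -> F) (io : L -> Q).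
Hypotheses (Hflat : flat F) (Hq : is_linear q) (qs : forall y, exists x, q x = y).
Hypotheses (Hio : is_linear io) (io_inj : injective io)
  (io_im : forall x, q x = 0 <-> exists l, io l = x).
Hypotheses (HQ : eq_flat Q) (HQp : projective Q).
Variables (rho u : Q -> Q).
Hypotheses (Hrho : is_linear rho) (Hu : is_linear u).
Hypothesis rho_inj : forall c, ideal_times I (rho c) -> ideal_times I c.
Hypothesis u_ker : forall l, exists c, ideal_times I (u (io l) - rho c).
Hypothesis u_compl : forall x, exists l, ideal_times I (x - u x - io l).
Hypothesis rho_ker : forall c, exists l, ideal_times I (rho c - io l).

Let itQ := it_sub I Q.

Lemma lift_mod (P E B : lmodType R) (f : E -> B) (g : P -> B) : projective P ->
  is_linear f -> is_linear g -> (forall y, exists x, ideal_times I (g y - f x)) ->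
  exists h : P -> E, is_linear h /\ forall y, ideal_times I (g y - f (h y)).
Proof.
move=> HP Hf Hg H; have [W [om [Hom [_ omk]]]] := quotient_exists (it_sub I B).
have [|h [Hh hE]] := HP _ _ _ _ (lin_comp Hom Hf) (lin_comp Hom Hg).
  move=> y; have [x Hx] := H y; exists x; apply/esym/subr0_eq.
  by rewrite -(linB Hom); apply/omk.
exists h; split=> // y; apply/omk; rewrite (linB Hom) hE subrr //.
Qed.

(** Modulo [I], [io l] is the sum of [u (io l)], which is some [rho c], and of [io l - u (io l)].
    Lifting [rho] and [1 - u] through [io] expresses [l] by [c] and [io l]; flatness brings the
    congruence from [IQ] back to [IL]. *)
Lemma core_maps : exists (lam kap : Q -> L),
  [/\ is_linear lam, is_linear kap, forall c, ideal_times I (rho c - io (lam c)),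
      forall x, ideal_times I (x - u x - io (kap x)) &
      forall l c, ideal_times I (u (io l) - rho c) ->
        ideal_times I (l - (lam c + kap (io l)))].
Proof.
have [lam [Hlam lamE]] := lift_mod HQp Hio Hrho rho_ker.
have [kap [Hkap kapE]] := lift_mod HQp Hio (lin_sub lin_id Hu) u_compl.
exists lam, kap; split=> // l c Hc; apply: (flat_ker_ideal Hflat Hq qs HI Hio io_inj io_im).
rewrite (linB Hio) (linD Hio).
have := subD itQ (subD itQ (kapE (io l)) Hc) (lamE c).
by congr (ideal_times I _); lmod.
Qed.

(** [phi] is the sum of [phi (lam c)] and [phi (kap (io l))]. The second term is defined on all of
    [Q]; the first is too, once [phi \o lam] is factored through [rho], because [rho c] is
    [u (io l)] modulo [I]. *)
Lemma extend_killed (D : lmodType R) (phi : L -> D) :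
  (forall a (d : D), I a -> a *: d = 0) ->
  (forall f : Q -> D, is_linear f -> exists psi, is_linear psi /\ forall x, psi (rho x) = f x) ->
  is_linear phi -> exists Phi : Q -> D, is_linear Phi /\ forall l, Phi (io l) = phi l.
Proof.
move=> killed ext Hphi; have [lam [kap [Hlam Hkap lamE kapE key]]] := core_maps.
have [psi [Hpsi psiE]] := ext _ (lin_comp Hphi Hlam).
exists (fun x => psi (u x) + phi (kap x)); split.
  by apply: lin_add; exact: lin_comp.
move=> l; have [c Hc] := u_ker l.
have -> : psi (u (io l)) = phi (lam c).
  apply/subr0_eq; rewrite -psiE -(linB Hpsi).
  by apply: (it_killed killed); exact: it_lin.
apply/subr0_eq; rewrite -(linD Hphi) -(linB Hphi) -[RHS]oppr0 -(it_killed killed (it_lin Hphi (key _ _ Hc))).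
by rewrite -(linN Hphi); congr phi; lmod.
Qed.

(** [be] maps the projective [B = Q * Q] onto [L], by Nakayama. The map [U] satisfies [be \o U = be]
    modulo [I] and vanishes modulo [I] on [Z = ker be], so [1 - U] lifts to some [w : B -> Z] that
    is the identity on [Z] modulo [IZ]. T-nilpotence inverts it on [Z], so [Z] splits off and [L] is
    a summand of [B]. *)
Lemma syzygy_projective : projective L.
Proof.
have [lam [kap [Hlam Hkap lamE kapE key]]] := core_maps.
pose B : lmodType R := (Q * Q)%type.
have HB : projective B by exact: pair_projective.
pose be (b : B) := lam b.1 + kap b.2.
have Hbe : is_linear be by move=> a x y; rewrite /be /= Hlam Hkap; lmod.
have bes l : exists b, be b = l.
  have H l' : exists y, (exists b, y = be b) /\ ideal_times I (l' - y).
    have [c Hc] := u_ker l'; exists (be (c, io l')); split; first by exists (c, io l').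
    exact: key.
  by have [b ->] := tnil_nakayama HT (im_sub Hbe) H l; exists b.
have [C [HC CE]] := lift_mod HB Hrho (lin_comp Hu (lin_comp Hio Hbe)) (fun b => u_ker (be b)).
pose U (b : B) : B := (C b, io (be b)).
have HU : is_linear U.
  move=> a x y; rewrite /U HC Hbe Hio; reflexivity.
have [Z [jz [Hjz [jzi jzP]]]] := submodule_exists (ker_sub Hbe).
have [w [Hw wE]] : exists w : B -> Z, is_linear w /\
    forall b, ideal_times I (b - U b - jz (w b)).
  apply: (lift_mod HB Hjz (lin_sub lin_id HU)) => b.
  have Hb : ideal_times I (be (b - U b)).
    have := key _ _ (CE b); congr (ideal_times I _).
    by rewrite (linB Hbe).
  have [b' [Ib' b'E]] := it_surj Hbe bes Hb.
  have [|z zE] := (jzP (b - U b - b')).1; first by rewrite (linB Hbe) b'E subrr.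
  by exists z; rewrite zE; congr (ideal_times I _) : Ib'; lmod_of R B.
pose nu z := z - w (jz z).
have Hnu : is_linear nu by apply: lin_sub => //; exact: lin_comp.
have bez z : be (jz z) = 0 by apply/jzP; exists z.
(* On [Z], [U] takes the value [(C (jz z), 0)], and [rho_inj] puts its first entry into [IQ];
   [flat_syzygy] then passes from [IB] to [IZ]. *)
have nuI z : ideal_times I (nu z).
  have UI : ideal_times I (U (jz z)).
    have H0 : ideal_times I (C (jz z)).
      apply: rho_inj; have := CE (jz z); rewrite bez (lin0 Hio) (lin0 Hu) sub0r.
      by move=> H; rewrite -[rho _]opprK -scaleN1r; apply: (subZ itQ).
    by rewrite /U bez (lin0 Hio); exact: (it_lin (@lin_inl _ Q Q) H0).
  have IB : ideal_times I (jz (nu z)).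
    have := subD (it_sub I B) (wE (jz z)) UI; congr (ideal_times I _).
    by rewrite /nu (linB Hjz); lmod_of R B.
  have /(_ (fun x => exists z', jz z' = x /\ ideal_times I z')) :=
    flat_syzygy Hflat Hq qs Hio io_inj io_im HQ Hbe bes IB (bez _).
  case=> [|_ [a [_ [Ia [/jzP [z' <-] ->]]]]|z' [/jzi -> //]].
    split=> [|a _ _ [x [<- Ix]] [y [<- Iy]]].
      by exists 0; rewrite (lin0 Hjz); split=> //; exact: (sub0 (it_sub _ _)).
    by exists (a *: x + y); rewrite Hjz; split=> //; case: (it_sub I Z) => _; apply.
  by exists (a *: z'); rewrite (linZ Hjz); split=> //; exact: it_gen.
have [v [Hv vE]] := tnil_unipotent HT Hnu nuI.
have rE z : v (w (jz z)) = z.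
  by rewrite -[RHS]vE /nu; congr v; lmod.
have Hr : is_linear (fun b => jz (v (w b))) by apply: lin_comp => //; exact: lin_comp.
move=> E Bt f g Hf Hg fs.
have [|ze [Hze zeE]] := HB _ _ _ _ Hf (lin_comp Hg Hbe); first by move=> b; exact: fs.
have [||h [Hh hE]] := @factor_surj _ _ _ _ be (fun b => ze (b - jz (v (w b)))) Hbe bes.
- by apply: lin_comp => //; apply: lin_sub.
- by move=> b /jzP [z <-]; rewrite rE subrr (lin0 Hze).
exists h; split=> // l; have [b <-] := bes l.
by rewrite hE zeE (linB Hbe) bez subr0.
Qed.
End Core.

(** * Scalars acting bijectively or as zero, and solvability in related modules *)

Definition bijscale (R : comPzRingType) (r : R) (C : lmodType R) : Prop :=
  (forall x : C, r *: x = 0 -> x = 0) /\ (forall x : C, exists y, r *: y = x).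
Definition killscale (R : comPzRingType) (r : R) (C : lmodType R) : Prop :=
  forall x : C, r *: x = 0.

(** The free object over [L] in the category of modules on which [U] acts bijectively and [Z] as
    zero: [U^-1 L] modulo all multiples by [Z]. The generator [e (l, w)] stands for the fraction
    [l / w]. *)
Lemma reflection_exists (R : comPzRingType) (U Z : R -> Prop) (L : lmodType R) :
  U 1 -> (forall u v, U u -> U v -> U (u * v)) ->
  exists (LA : lmodType R) (eta : L -> LA),
  [/\ is_linear eta, forall r, U r -> bijscale r LA, forall r, Z r -> killscale r LA,
    forall (C : lmodType R) (phi : L -> C), (forall r, U r -> bijscale r C) ->
      (forall r, Z r -> killscale r C) -> is_linear phi ->
      exists psi : LA -> C, is_linear psi /\ forall l, psi (eta l) = phi l &
    forall (C : lmodType R) (f g : LA -> C), (forall r, U r -> bijscale r C) ->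
      is_linear f -> is_linear g -> (forall l, f (eta l) = g (eta l)) -> forall x, f x = g x].
Proof.
move=> U1 UM.
have [US [sv [svU svS]]] : exists (US : Type) (sv : US -> R),
    (forall w, U (sv w)) /\ forall r, U r -> exists w, sv w = r.
  by exists {w : R | U w}, sval; split=> [[]|r Ur] //; exists (exist _ r Ur).
have [Q [e [[univ gen] _]]] := free_exists R (L * US)%type.
pose rel (z : Q) := [\/
  exists a l l' w, z = e (a *: l + l', w) - (a *: e (l, w) + e (l', w)),
  exists l (w w' : US) u, [/\ U u, sv w' = u * sv w & z = u *: e (l, w') - e (l, w)] |
  exists r l w, Z r /\ z = r *: e (l, w)].
have [LA [ka [Hka [kas kak]]]] := quotient_exists (lspan_sub rel).
have [one oneE] := svS _ U1.
have kgen (C : lmodType R) (f g : LA -> C) : is_linear f -> is_linear g ->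
    (forall t, f (ka (e t)) = g (ka (e t))) -> forall x, f x = g x.
  move=> Hf Hg H x; have [z <-] := kas x; apply/subr0_eq; move: z.
  apply: (gen (fun z => f (ka z) - g (ka z) = 0)) => [|t]; last by rewrite H subrr.
  apply: (@ker_sub _ _ _ (fun z => f (ka z) - g (ka z))).
  by apply: lin_sub; exact: lin_comp.
have krel z : rel z -> ka z = 0 by move=> Hz; apply/kak; exact: lspan_gen.
have k1 a l l' w : ka (e (a *: l + l', w)) = a *: ka (e (l, w)) + ka (e (l', w)).
  apply/subr0_eq; rewrite -Hka -(linB Hka); apply: krel; apply: Or31.
  by exists a, l, l', w.
have k2 l w w' u : U u -> sv w' = u * sv w -> u *: ka (e (l, w')) = ka (e (l, w)).
  move=> Uu E; apply/subr0_eq; rewrite -(linZ Hka) -(linB Hka); apply: krel.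
  by apply: Or32; exists l, w, w', u.
have from_rel (C : lmodType R) (y : L -> US -> C) :
    (forall a l l' w, y (a *: l + l') w = a *: y l w + y l' w) ->
    (forall l w w' u, U u -> sv w' = u * sv w -> u *: y l w' = y l w) ->
    (forall r, Z r -> killscale r C) ->
    exists f : LA -> C, is_linear f /\ forall l w, f (ka (e (l, w))) = y l w.
  move=> y1 y2 y3; have [h [Hh hE]] := univ C (fun lw => y lw.1 lw.2).
  have [|f [Hf fE]] := factor_surj Hka kas Hh; last first.
    by exists f; split=> // l w; rewrite fE hE.
  move=> z /kak Hz; apply: (Hz _ (ker_sub Hh)) => z' [].
  - by move=> [a [l [l' [w ->]]]]; rewrite (linB Hh) Hh !hE /= y1 subrr.
  - by move=> [l [w [w' [u [Uu E ->]]]]]; rewrite (linB Hh) (linZ Hh) !hE /= (y2 l w w') // subrr.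
  - by move=> [r [l [w [Zr ->]]]]; rewrite (linZ Hh) hE; exact: y3.
have LAZ r : Z r -> killscale r LA.
  move=> Zr; apply: (kgen _ _ (fun _ => 0)); [exact: lin_scale lin_id | exact: lin_zero|].
  by move=> [l w]; rewrite -(linZ Hka); apply: krel; apply: Or33; exists r, l, w.
exists LA, (fun l => ka (e (l, one))); split=> //.
- move=> u Uu; have [up upE] := choice (fun w => svS _ (UM _ _ Uu (svU w))).
  have [|||th [Hth thE]] := from_rel LA (fun l w => ka (e (l, up w))).
  + by move=> a l l' w; exact: k1.
  + by move=> l w w' v Uv E; apply: k2 => //; rewrite !upE E; ring.
  + exact: LAZ.
  have uth x : u *: th x = x.
    move: x; apply: kgen => [||[l w]] //; first exact: lin_scale.
    by rewrite thE; apply: k2 => //; exact: upE.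
  split=> [x ux|x]; last by exists (th x).
  by rewrite -(uth x) -(linZ Hth) ux (lin0 Hth).
- move=> C phi CU CZ Hphi.
  have [y yE] : exists y : L -> US -> C, forall l w, sv w *: y l w = phi l.
    have [f fE] := choice (fun lw : L * US => (CU _ (svU lw.2)).2 (phi lw.1)).
    by exists (fun l w => f (l, w)) => l w; exact: (fE (l, w)).
  have inj (w : US) (x x' : C) : sv w *: x = sv w *: x' -> x = x'.
    move=> E; apply/subr0_eq; apply: (CU _ (svU w)).1.
    by rewrite scalerBr E subrr.
  have [|||psi [Hpsi psiE]] := from_rel C y.
  + move=> a l l' w; apply: (inj w); rewrite /= yE Hphi -(yE l w) -(yE l' w).
    by lmod.
  + move=> l w w' u Uu E; apply: (inj w); rewrite /= yE -(yE l w') E.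
    by lmod.
  + exact: CZ.
  exists psi; split=> // l; by rewrite psiE -(yE l one) oneE scale1r.
- move=> C f g CU Hf Hg H; apply: kgen => // -[l w].
  apply/subr0_eq; apply: (CU _ (svU w)).1.
  rewrite scalerBr -(linZ Hf) -(linZ Hg) (k2 l one w) ?H ?subrr //.
  by rewrite oneE mulr1.
Qed.

Lemma coherent_exists (R : comPzRingType) (C : lmodType R) (t : nat -> R) :
  exists (C0 : lmodType R) (pr : C0 -> nat -> C),
  [/\ is_linear pr, injective pr, forall x n, pr x n = t n *: pr x n.+1 &
      forall s : nat -> C, (forall n, s n = t n *: s n.+1) -> exists x, pr x = s].
Proof.
have Hs : submodule (fun s : nat -> C => forall n, s n = t n *: s n.+1).
  split=> [n|a x y Hx Hy n]; first by rewrite -[LHS]/(0 : C) -[RHS]/(t n *: (0 : C)) scaler0.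
  rewrite -[LHS]/(a *: x n + y n) -[RHS]/(t n *: (a *: x n.+1 + y n.+1)) Hx Hy; lmod.
have [C0 [pr [H1 [H2 H3]]]] := submodule_exists Hs.
exists C0, pr; split=> // [x|s]; last by move/H3.
by apply/H3; exists x.
Qed.

Lemma solvable_divisible (R : comPzRingType) (C : lmodType R) (t : nat -> R) :
  (forall n (x : C), exists y, t n *: y = x) -> solvable_for t C.
Proof.
move=> H c; have /choice [d dE] : forall nx : nat * C, exists y, t nx.1 *: y = nx.2.
  by move=> [n x]; exact: H.
pose x := fix x n := if n is n'.+1 then d (n', x n' - c n') else 0.
by exists x => n /=; rewrite (dE (n, _)) /=; lmod.
Qed.

Lemma solvable_killed (R : comPzRingType) (C : lmodType R) (t : nat -> R) N :
  (forall n, (N <= n)%N -> killscale (t n) C) -> solvable_for t C.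
Proof.
move=> H c; pose S n k := \sum_(i < k) tseg t n i *: c (n + i)%N.
have SS n k : S n k.+1 = c n + t n *: S n.+1 k.
  rewrite /S big_ord_recl tseg0 scale1r addn0 scaler_sumr; congr (_ + _).
  by apply: eq_bigr => i _; rewrite scalerA -tsegS /= /bump addSnnS.
(* With [N.+1] terms the last coefficient, once multiplied by [t n], contains [t (n + N)], which
   annihilates [C]; so cutting the series off does no harm. *)
exists (fun n => S n N.+1) => n; rewrite SS.
have -> : S n.+1 N.+1 = S n.+1 N + tseg t n.+1 N *: c (n.+1 + N)%N.
  by rewrite /S big_ord_recr.
suff -> : t n *: (S n.+1 N + tseg t n.+1 N *: c (n.+1 + N)%N) = t n *: S n.+1 N by lmod.
by rewrite scalerDr scalerA -tsegS tsegSr -scalerA (H _ (leq_addl n N)) scaler0 addr0.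
Qed.

Lemma solvable_quot (R : comPzRingType) (C W : lmodType R) (om : C -> W) (t : nat -> R) :
  is_linear om -> (forall w, exists x, om x = w) -> solvable_for t C -> solvable_for t W.
Proof.
move=> Hom oms H c; have [d dE] := choice (fun n => oms (c n)).
have [x xE] := H d; exists (fun n => om (x n)) => n.
by rewrite -dE -xE (linB Hom) (linZ Hom).
Qed.

(* The diagonal trick: a [tJ]-system in coherent sequences is read off from a
   [tJ * t]-system for the diagonal entries. *)
Lemma solvable_coherent (R : comPzRingType) (C C0 : lmodType R) (t tJ : nat -> R)
  (pr : C0 -> nat -> C) : is_linear pr -> injective pr ->
  (forall x n, pr x n = t n *: pr x n.+1) ->
  (forall s : nat -> C, (forall n, s n = t n *: s n.+1) -> exists x, pr x = s) ->
  solvable_for (fun n => tJ n * t n) C -> solvable_for tJ C0.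
Proof.
move=> Hpr pri prc prs H c; have [y yE] := H (fun n => pr (c n) n).
have prshift x n k : pr x n = tseg t n k *: pr x (n + k)%N.
  elim: k => [|k IH]; first by rewrite tseg0 scale1r addn0.
  by rewrite IH prc scalerA tsegSr addnS.
(* The [k]-th entry of the [n]-th unknown, obtained by unrolling the system up to index [N] and
   replacing the tail by a multiple of the diagonal entry [y N]. It does not depend on [N]. *)
pose f n k N := \sum_(i < N - n) tseg tJ n i *: pr (c (n + i)%N) k
  + (tseg tJ n (N - n) * tseg t k (N - k)) *: y N.
have fN n k N : (n <= N)%N -> (k <= N)%N -> f n k N = f n k N.+1.
  move=> nN kN; rewrite /f !subSn // big_ord_recr /= subnKC // !tsegSr !subnKC //.
  have -> : y N = pr (c N) N + (tJ N * t N) *: y N.+1 by rewrite -yE; lmod.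
  rewrite (prshift (c N) k (N - k)%N) subnKC //.
  by set S := \sum_(_ < _) _; set a := tseg tJ _ _; set b := tseg t _ _; lmod.
have fD n k N d : (n <= N)%N -> (k <= N)%N -> f n k N = f n k (N + d)%N.
  move=> nN kN; elim: d => [|d IH]; first by rewrite addn0.
  by rewrite addnS -fN // -?IH //; apply: leq_trans (leq_addr _ _).
pose x n k := f n k (n + k)%N.
have xE n k N : (n <= N)%N -> (k <= N)%N -> x n k = f n k N.
  move=> nN kN; rewrite /x (fD n k (n + k)%N N) ?leq_addl ?leq_addr //.
  by rewrite addnC -fD.
have /choice [z zE] : forall n, exists z, pr z = x n.
  move=> n; apply: prs => k; set N := (n + k.+1)%N.
  have h1 : (n <= N)%N by exact: leq_addr.
  have h2 : (k.+1 <= N)%N by exact: leq_addl.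
  rewrite (xE n k N) // 1?ltnW // (xE n k.+1 N) // /f scalerDr scaler_sumr.
  congr (_ + _).
    apply: eq_bigr => i _; rewrite [in LHS]prc; lmod.
  by rewrite -(subnSK h2) tsegS; set a := tseg tJ _ _; set b := tseg t _ _; lmod.
exists z => n; apply: pri; rewrite (linB Hpr) (linZ Hpr) !zE; apply/funext => k.
rewrite -[LHS]/(x n k - tJ n *: x n.+1 k); set N := (n.+1 + k)%N.
have h1 : (n.+1 <= N)%N by exact: leq_addr.
have h2 : (k <= N)%N by exact: leq_addl.
rewrite (xE n k N) // 1?ltnW // (xE n.+1 k N) // /f -(subnSK h1) tsegS.
rewrite big_ord_recl tseg0 scale1r addn0 scalerDr scaler_sumr.
rewrite [X in _ + X + _ - _](eq_bigr (fun i : 'I_(N - n.+1) =>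
  tJ n *: (tseg tJ n.+1 i *: pr (c (n.+1 + i)%N) k))); last first.
  by move=> i _; rewrite scalerA -tsegS /= /bump addSnnS.
by set S := \sum_(_ < _) _; set a := tseg tJ _ _; set b := tseg t _ _; lmod.
Qed.

(** * Extending maps from the syzygy *)

Lemma bijscale1 (R : comPzRingType) (C : lmodType R) : bijscale 1 C.
Proof. by split=> [x|x]; [rewrite scale1r | exists x; rewrite scale1r]. Qed.
Lemma bijscaleM (R : comPzRingType) (C : lmodType R) (r s : R) :
  bijscale r C -> bijscale s C -> bijscale (r * s) C.
Proof.
move=> [ri rs] [si ss]; split=> x; first by rewrite -scalerA => /ri/si.
have [y <-] := rs x; have [z <-] := ss y; exists z; by rewrite scalerA.
Qed.

Lemma tel_dvd_tel (R : comPzRingType) (e : nat -> R) n m : (n <= m)%N ->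
  exists u, tel e m = tel e n * u.
Proof.
move=> /subnKC <-; elim: (m - n)%N => [|d [u IH]]; first by exists 1; rewrite addn0 mulr1.
exists (u * e (n + d).+1); rewrite addnS /tel big_ord_recr -/(tel e (n + d)) IH /=.
by rewrite mulrA.
Qed.

Section Claim.
Variables (R : comPzRingType) (I : R -> Prop).
Hypothesis HT : T_nilpotent I.
Variables (Q L : lmodType R) (io : L -> Q).
Hypotheses (Hio : is_linear io) (HQp : projective Q) (HLp : projective L).
Variables (m : nat) (e : 'I_m -> nat -> R).

Definition tJ (J : {set 'I_m}) (n : nat) : R := \prod_(j in J) tel (e j) n.

Definition extendable (C : lmodType R) : Prop := forall phi : L -> C, is_linear phi ->
  exists Phi : Q -> C, is_linear Phi /\ forall l, Phi (io l) = phi l.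

Hypothesis ext_killed : forall D : lmodType R, (forall a (d : D), I a -> a *: d = 0) ->
  (forall j, solvable_for (tel (e j)) D) -> extendable D.

Definition pure_at (C : lmodType R) (j : 'I_m) : Prop :=
  (forall i, bijscale (e j i) C) \/ (exists n, killscale (tel (e j) n) C).

(** [phi] is replaced by the universal map [eta : L -> LA]. An extension modulo [I] lifts to
    [r : Q -> LA], and the error [eta - r \o io] has the form [nu \o eta] with [nu] an endomorphism
    of [LA] that vanishes modulo [I]. So [1 - nu] is invertible and corrects [r]. *)
Lemma pure_extendable (C : lmodType R) : (forall j, pure_at C j) -> extendable C.
Proof.
move=> HC phi Hphi.
have [LA [eta [Heta LAU LAZ univ uniq]]] := @reflection_exists R
  (fun r => bijscale r C) (fun r => killscale r C) L (bijscale1 C) (@bijscaleM R C).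
have [W [om [Hom [oms omk]]]] := quotient_exists (it_sub I LA).
have WU r : bijscale r C -> bijscale r W.
  move=> /LAU [ri rs]; split=> [w|w]; have [x <-] := oms w.
    rewrite -(linZ Hom) => /omk Ix; apply/omk.
    (* Multiplication by [r] maps [LA] onto itself, hence also [I LA] onto itself; this makes it
       injective on the quotient. *)
    have [x' [Ix' E]] := it_surj (lin_scale r lin_id) rs Ix.
    suff -> : x = x' by [].
    by apply/esym/subr0_eq; apply: ri; rewrite scalerBr E subrr.
  by have [y <-] := rs x; exists (om y); rewrite -(linZ Hom).
have WZ r : killscale r C -> killscale r W.
  by move=> /LAZ H w; have [x <-] := oms w; rewrite -(linZ Hom) H (lin0 Hom).
have Wsol j : solvable_for (tel (e j)) W.
  case: (HC j) => [Hb|[n Hn]].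
    apply: solvable_divisible => n; have [] // := WU (tel (e j) n).
    apply: (big_ind (fun r => bijscale r C)) => //; first exact: bijscale1.
    by move=> r s; exact: bijscaleM.
  apply: (@solvable_killed _ _ _ n) => k nk; apply: WZ => x.
  by have [u ->] := tel_dvd_tel (e j) nk; rewrite -scalerA Hn.
have WI a (w : W) : I a -> a *: w = 0.
  by move=> Ia; have [x <-] := oms w; rewrite -(linZ Hom); apply/omk; exact: it_gen.
have [Ph [HPh PhE]] := ext_killed WI Wsol (lin_comp Hom Heta).
have [|r [Hr rE]] := HQp Hom HPh; first by move=> y; exact: oms.
have [nu [Hnu nuE]] := univ LA _ LAU LAZ (lin_sub Heta (lin_comp Hr Hio)).
have nuI x : ideal_times I (nu x).
  apply/omk; apply: (uniq W (fun x => om (nu x)) (fun _ => 0) WU).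
  - exact: lin_comp.
  - exact: lin_zero.
  - by move=> l; rewrite nuE (linB Hom) rE PhE subrr.
have [v [Hv vE]] := tnil_unipotent HT Hnu nuI.
have [psi [Hpsi psiE]] := univ C phi (fun r H => H) (fun r H => H) Hphi.
exists (fun x => psi (v (r x))); split; first by apply: lin_comp => //; exact: lin_comp.
move=> l; rewrite -psiE -[in RHS](vE (eta l)) nuE; congr (psi (v _)); lmod.
Qed.

Lemma telescope_extendable (C : lmodType R) (t : nat -> R) :
  solvable_for t C ->
  (forall n (W : lmodType R) (om : C -> W), is_linear om -> (forall w, exists x, om x = w) ->
    (forall x, om x = 0 <-> exists y, x = t n *: y) -> extendable W) ->
  (forall (C0 : lmodType R) (pr : C0 -> nat -> C), is_linear pr -> injective pr ->
    (forall x n, pr x n = t n *: pr x n.+1) ->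
    (forall s : nat -> C, (forall n, s n = t n *: s n.+1) -> exists x, pr x = s) ->
    extendable C0) -> extendable C.
Proof.
move=> sol HW HC0 phi Hphi.
have step n (a : L -> C) : is_linear a -> exists (c : Q -> C) (a' : L -> C),
    [/\ is_linear c, is_linear a' & forall l, a l = c (io l) + t n *: a' l].
  move=> Ha; have Ht : is_linear (fun x : C => t n *: x) by exact: lin_scale lin_id.
  have [W [om [Hom [oms omk]]]] := quotient_exists (im_sub Ht).
  have [Ph [HPh PhE]] := HW n W om Hom oms omk _ (lin_comp Hom Ha).
  have [|c [Hc cE]] := HQp Hom HPh; first by move=> y; exact: oms.
  have Hac : is_linear (fun l => a l - c (io l)).
    by apply: lin_sub => //; exact: lin_comp.
  have [|a' [Ha' a'E]] := HLp Ht Hac.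
    move=> l; have [|y E] := (omk (a l - c (io l))).1; last by exists y.
    by rewrite (linB Hom) cE PhE subrr.
  by exists c, a'; split=> // l; rewrite a'E; lmod.
have /choice [S SP] : forall na : nat * (L -> C), exists ca : (Q -> C) * (L -> C),
    is_linear na.2 -> [/\ is_linear ca.1, is_linear ca.2 &
      forall l, na.2 l = ca.1 (io l) + t na.1 *: ca.2 l].
  move=> [n a]; have [Ha|nH] := EM (is_linear a); last by exists (fun _ => 0, a).
  by have [c [a' H]] := step n a Ha; exists (c, a').
pose a := fix a n := if n is n'.+1 then (S (n', a n')).2 else phi.
have aL n : is_linear (a n).
  by elim: n => [//|n IH]; have [_ H _] := SP (n, a n) IH.
pose c n := (S (n, a n)).1.
have cL n : is_linear (c n) by have [H _ _] := SP (n, a n) (aL n).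
have aE n l : a n l = c n (io l) + t n *: a n.+1 l.
  by have [_ _ H] := SP (n, a n) (aL n); exact: H.
pose de (x : nat -> C) : nat -> C := fun n => x n - t n *: x n.+1.
have Hde : is_linear de.
  move=> r x y; apply/funext => n.
  rewrite -[LHS]/(r *: x n + y n - t n *: (r *: x n.+1 + y n.+1)).
  rewrite -[RHS]/(r *: (x n - t n *: x n.+1) + (y n - t n *: y n.+1)); lmod.
have Hc : is_linear ((fun y n => c n y) : Q -> nat -> C).
  by move=> r x y; apply/funext => n; rewrite cL.
(* Solvability says that [de] is onto; projectivity of [Q] then makes the solution depend linearly
   on [y]. *)
have [|x [Hx xE]] := HQp Hde Hc.
  by move=> y; have [x xE] := sol (fun n => c n y); exists x; apply/funext.
have {}xE n y : x y n - t n *: x y n.+1 = c n y.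
  by rewrite -[LHS]/(de (x y) n) xE.
have [C0 [pr [Hpr pri prc prs]]] := coherent_exists C t.
have Hd : is_linear ((fun l n => a n l - x (io l) n) : L -> nat -> C).
  move=> r l l'; apply/funext => n; rewrite aL Hio Hx.
  rewrite -[X in _ - X]/(r *: x (io l) n + x (io l') n).
  rewrite -[RHS]/(r *: (a n l - x (io l) n) + (a n l' - x (io l') n)); lmod.
(* [a n] and [x (io l) n] satisfy the same recursion, so their difference is a coherent sequence. *)
have [|d [HdL dE]] := factor_inj Hpr pri Hd.
  move=> l; apply: prs => n; have := xE n (io l).
  move=> E; rewrite (aE n l) -E; lmod.
have [ee [Hee eeE]] := HC0 C0 pr Hpr pri prc prs d HdL.
exists (fun y => x y 0%N + pr (ee y) 0%N); split.
  move=> r y y'; rewrite Hx Hee Hpr.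
  rewrite -[LHS]/((r *: x y 0%N + x y' 0%N) + (r *: pr (ee y) 0%N + pr (ee y') 0%N)); lmod.
by move=> l; rewrite eeE dE /=; lmod.
Qed.

(** Induction on the number of indices that need not be pure. The last of them, [j0], becomes pure
    both in [C / t n], which [t n] annihilates, and in the coherent sequences, where every [e j0 i]
    is invertible. The latter costs a factor [tel (e j0)] in the systems, so subsets [J] are
    needed. *)
Lemma extendable_below k (C : lmodType R) :
  (forall J : {set 'I_m}, (forall j, j \in J -> (j < k)%N) -> solvable_for (tJ J) C) ->
  (forall j : 'I_m, (k <= j)%N -> pure_at C j) -> extendable C.
Proof.
elim: k C => [|k IH] C HJ Hp; first by apply: pure_extendable => j; exact: Hp.
have [km|mk] := ltnP k m; last first.
  apply: IH => [J HJk|j kj]; first by apply: HJ => j /HJk; exact: ltnW.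
  by move: (ltn_ord j); rewrite ltnNge (leq_trans mk kj).
pose j0 := Ordinal km; apply: (@telescope_extendable C (tel (e j0))).
- have := HJ [set j0]; rewrite (_ : tJ [set j0] = tel (e j0)).
    by apply=> j; rewrite inE => /eqP ->.
  by apply/funext => n; rewrite /tJ big_set1.
- move=> n W om Hom oms omk; apply: IH => [J HJk|j].
    by apply: (solvable_quot Hom oms); apply: HJ => j /HJk; exact: ltnW.
  rewrite leq_eqVlt => /orP [/eqP kj|kj].
    right; exists n => w; have [x <-] := oms w.
    have -> : j = j0 by exact/val_inj.
    by rewrite -(linZ Hom); apply/omk; exists x.
  case: (Hp j kj) => [Hb|[n' Hn']].
    left=> i; have [bi bs] := Hb i; split=> w; have [x <-] := oms w; last first.
      by have [y <-] := bs x; exists (om y); rewrite -(linZ Hom).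
    rewrite -(linZ Hom) => /omk [y E]; apply/omk.
    have [y' yE] := bs y; exists y'; apply/subr0_eq; apply: bi.
    rewrite scalerBr E -yE; lmod.
  by right; exists n' => w; have [x <-] := oms w; rewrite -(linZ Hom) Hn' (lin0 Hom).
- move=> C0 pr Hpr pri prc prs; apply: IH => [J HJk|j].
    have j0J : j0 \notin J by apply/negP => /HJk; rewrite ltnn.
    apply: (solvable_coherent Hpr pri prc prs).
    have := HJ (j0 |: J); rewrite (_ : tJ (j0 |: J) = fun n => tJ J n * tel (e j0) n).
      by apply=> j; rewrite !inE => /orP [/eqP ->|/HJk]; [exact: ltnSn | exact: ltnW].
    by apply/funext => n; rewrite /tJ big_setU1 //= mulrC.
  have prinj x : (forall n, pr x n = 0) -> x = 0.
    by move=> H; apply: pri; rewrite (lin0 Hpr); apply/funext.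
  have prZ r x n : pr (r *: x) n = r *: pr x n by rewrite (linZ Hpr).
  rewrite leq_eqVlt => /orP [/eqP kj|kj].
    have -> : j = j0 by exact/val_inj.
    left=> i; have /choice [w wE] : forall n, exists w, (i <= n)%N -> tel (e j0) n = e j0 i * w.
      move=> n; have [le|lt] := leqP i n; last by exists 0.
      by have [w wE] := tel_dvd (e j0) le; exists w.
    have prs' x n d : pr x n = tseg (tel (e j0)) n d *: pr x (n + d)%N.
      elim: d => [|d IHd]; first by rewrite tseg0 scale1r addn0.
      by rewrite IHd prc scalerA tsegSr addnS.
    split=> x.
      move=> Ex; apply: prinj => n; rewrite (prs' x n i) prc wE ?leq_addl //.
      have := prZ (e j0 i) x (n + i).+1; rewrite Ex (lin0 Hpr) => E.
      rewrite [_ * w _]mulrC -[(w _ * _) *: _]scalerA -E scaler0 scaler0 //.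
    (* Division of [x] by [e j0 i]: writing the [n]-th entry through the entry at [(n + i).+1]
       produces the factor [tel (e j0) (n + i)], from which [e j0 i] is cancelled. *)
    have [|y yE] := prs (fun n => (tseg (tel (e j0)) n i * w (n + i)%N) *: pr x (n + i).+1).
      move=> n; rewrite (prc x (n + i).+1) addSn.
      rewrite !scalerA.
      have E1 := wE (n + i)%N (leq_addl _ _); have E2 := wE (n + i).+1 (leqW (leq_addl _ _)).
      have E3 : tseg (tel (e j0)) n i * tel (e j0) (n + i)%N =
          tel (e j0) n * tseg (tel (e j0)) n.+1 i by rewrite -tsegSr tsegS.
      congr (_ *: _).
      transitivity (tseg (tel (e j0)) n i * (e j0 i * w (n + i)%N) * w (n + i).+1).
        by rewrite E2; ring.
      by rewrite -E1 E3; ring.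
    exists y; apply: pri; apply/funext => n; rewrite prZ yE [RHS](prs' x n i) (prc x (n + i)%N) wE ?leq_addl //.
    by rewrite !scalerA; congr (_ *: _); ring.
  case: (Hp j kj) => [Hb|[n' Hn']].
    left=> i; have [bi bs] := Hb i; split=> x.
      by move=> Ex; apply: prinj => n; apply: bi; rewrite -prZ Ex (lin0 Hpr).
    have [y yE] := choice (fun n => bs (pr x n)).
    have [n|z zE] := prs y.
      apply/subr0_eq; apply: bi; rewrite scalerBr yE prc -yE; lmod.
    by exists z; apply: pri; apply/funext => n; rewrite prZ zE yE.
  by right; exists n' => x; apply: prinj => n; rewrite prZ Hn'.
Qed.

Lemma all_solvable_extendable (C : lmodType R) :
  (forall J, solvable_for (tJ J) C) -> extendable C.
Proof.
move=> H; apply: (@extendable_below m) => [J _|j mj]; first exact: H.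
by move: (ltn_ord j); rewrite ltnNge mj.
Qed.
End Claim.

(** * Adjoining solutions of systems *)

Lemma well_order_sum (Y X : Type) (lt : Y -> Y -> Prop) (lt' : X -> X -> Prop) :
  Defs.well_order lt -> Defs.well_order lt' ->
  Defs.well_order (fun a b : Y + X => match a, b with
    | inl y, inl z => lt y z | inr y, inr z => lt' y z
    | inl _, inr _ => True | inr _, inl _ => False end).
Proof.
move=> [tr [tot wf]] [tr' [tot' wf']]; split; [|split].
- by move=> [x|x] [y|y] [z|z] //; [exact: tr | exact: tr'].
- move=> [x|x] [y|y]; [|by right; left|by right; right|].
    by case: (tot x y) => [->|]; [left|right].
  by case: (tot' x y) => [->|]; [left|right].
- have accl y : Acc (fun a b : Y + X => match a, b with
      | inl y, inl z => lt y z | inr y, inr z => lt' y z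
      | inl _, inr _ => True | inr _, inl _ => False end) (inl y).
    elim: (wf y) => {}y _ IH; apply: Acc_intro; case=> [z zy|z H]; last by case: H.
    exact: IH.
  case=> y; first exact: accl.
  elim: (wf' y) => {}y _ IH; apply: Acc_intro; case=> [z _|z zy]; first exact: accl.
  exact: IH.
Qed.

Section Precover.
Variables (R : comPzRingType) (A : Type) (e : A -> nat -> R).

Lemma free_telescoping (T : Type) (Q : lmodType R) (b : T -> Q) (a0 : A) :
  (forall n, tel (e a0) n = 1) -> free_on b -> telescoping e Q.
Proof.
move=> e1 Hb; have [lt wo] := well_order_exists T.
exists T, lt, (fun _ => a0), (fun t _ => b t); split=> //.
- by move=> y n; rewrite e1 scale1r subrr; exact: (sub0 (lspan_sub _)).
- move=> y n r Hr; exists 0%N; rewrite tseg0 mulr1.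
  have [f [Hf fE]] := Hb.1 (R^o : lmodType R) (fun t => if pselect (t = y) then 1 else 0).
  have : f (r *: b y) = 0.
    apply: (Hr _ (ker_sub Hf)) => _ [z [k [zy ->]]]; rewrite fE; case: pselect => // E.
    by case: (wo_irr wo (x := y)); rewrite -{1}E.
  by rewrite (linZ Hf) fE; case: pselect => // ?; rewrite /GRing.scale /= mulr1.
- move=> x; apply: Hb.2; first exact: lspan_sub.
  by move=> t; apply: lspan_gen; exists t, 0%N.
Qed.

(** A universal solution [x_ c] is adjoined for all sequences [c] in [ker p] at once, each giving
    one new telescope step. The last clause records that the new kernel is divisible by every
    [tel (e a) n] modulo the old one. *)
Lemma adjoin_solutions (G F : lmodType R) (p : G -> F) (a : A) :
  is_linear p -> telescoping e G ->
  exists (G1 : lmodType R) (i : G -> G1) (p1 : G1 -> F),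
  [/\ is_linear i /\ is_linear p1, forall x, p1 (i x) = p x, telescoping e G1,
    forall c : nat -> G, (forall n, p (c n) = 0) ->
      exists x, (forall n, p1 (x n) = 0) /\ system (tel (e a)) (fun n => i (c n)) x &
    forall x n, p1 x = 0 -> exists y c,
      [/\ p1 y = 0, p c = 0 & x = tel (e a) n *: y + i c]].
Proof.
move=> Hp [Y [lt [ty [g [wo gS gT gG]]]]]; pose t := tel (e a).
(* Entries outside [ker p] are replaced by 0, so that all sequences can serve as indices. *)
pose X := nat -> G; pose cl (c : X) : X := fun n => if pselect (p (c n) = 0) then c n else 0.
have clp c n : p (cl c n) = 0 by rewrite /cl; case: pselect => // ?; exact: lin0.
have [Fr [b [[univ gen] _]]] := free_exists R (X * nat)%type.
pose H : lmodType R := (G * Fr)%type.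
pose rel (z : H) := exists c n, z = (- cl c n, b (c, n) - t n *: b (c, n.+1)).
have [G1 [ka [Hka [kas kak]]]] := quotient_exists (lspan_sub rel).
have inlL := @lin_inl _ G Fr; have inrL := @lin_inr _ G Fr.
pose i x := ka (x, 0); pose x_ c n := ka (0, b (c, n)).
have Hi : is_linear i by exact: (lin_comp Hka inlL).
have xE c n : x_ c n - t n *: x_ c n.+1 = i (cl c n).
  apply/subr0_eq; rewrite /x_ /i -(linZ Hka) -!(linB Hka); apply/kak; apply: lspan_gen.
  exists c, n; rewrite -[LHS]/(0 - t n *: 0 - cl c n, b (c, n) - t n *: b (c, n.+1) - 0).
  by rewrite scaler0 subr0 sub0r subr0.
have map_out (D : lmodType R) (f : G -> D) (y : X -> nat -> D) : is_linear f ->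
    (forall c n, y c n - t n *: y c n.+1 = f (cl c n)) ->
    exists h : G1 -> D, [/\ is_linear h, forall x, h (i x) = f x & forall c n, h (x_ c n) = y c n].
  move=> Hf yE; have [k [Hk kE]] := univ D (fun cn => y cn.1 cn.2).
  have Hs : is_linear (fun z : H => f z.1 + k z.2).
    by move=> r z z'; rewrite /= Hf Hk; lmod.
  have [|h [Hh hE]] := factor_surj Hka kas Hs.
    move=> z /kak Hz; apply: (Hz _ (ker_sub Hs)) => _ [c [n ->]] /=.
    by rewrite (linN Hf) (linB Hk) (linZ Hk) !kE /= yE addNr.
  exists h; split=> // [x|c n]; rewrite hE /=; first by rewrite (lin0 Hk) addr0.
  by rewrite (lin0 Hf) add0r kE.
have G1gen (S : G1 -> Prop) : submodule S -> (forall x, S (i x)) ->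
    (forall c n, S (x_ c n)) -> forall x, S x.
  move=> HS Si Sx x; have [[u v] <-] := kas x; rewrite pair_split (linD Hka).
  apply: subD => //; first exact: Si.
  apply: (gen (fun v => S (ka (0, v)))) => [|[c n]]; last exact: Sx.
  exact: (preim_sub (lin_comp Hka inrL) HS).
have [|p1 [Hp1 p1i p1x]] := map_out F p (fun _ _ => 0) Hp.
  by move=> c n; rewrite clp; lmod.
exists G1, i, p1; split=> //.
- have [ltX woX] := well_order_exists X.
  pose g1 (y : Y + X) n := match y with inl y => i (g y n) | inr c => x_ c n end.
  exists (Y + X)%type, (fun a b : Y + X => match a, b with
    | inl y, inl z => lt y z | inr y, inr z => ltX y z
    | inl _, inr _ => True | inr _, inl _ => False end),
    (fun y => match y with inl y => ty y | inr _ => a end), g1.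
  (* [G] embeds in its germs, where all the systems are solvable, so this embedding extends to
     [G1]. *)
  have i_inj x : i x = 0 -> x = 0.
    have [D [germ [Hg [_ [gk gsol]]]]] := germ_exists G.
    have cL : is_linear (fun x => germ (fun _ => x)) by move=> r u v; rewrite -Hg.
    have [y yE] := choice (fun c : X => gsol t (fun n => germ (fun _ => cl c n))).
    have [h [Hh hi _]] := map_out D _ y cL yE.
    by move=> E; have := hi x; rewrite E (lin0 Hh) => /esym /gk [N /(_ N (leqnn N))].
  have i_slt y x : slt lt g y x -> slt (fun a b : Y + X => match a, b with
    | inl y, inl z => lt y z | inr y, inr z => ltX y z
    | inl _, inr _ => True | inr _, inl _ => False end) g1 (inl y) (i x).
    move=> Hx; apply: (lspan_map Hi) Hx => _ [z [n [zy ->]]].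
    by apply: lspan_gen; exists (inl z), n.
  split.
  + exact: well_order_sum.
  + case=> [y|c] n /=; first by rewrite -(linZ Hi) -(linB Hi); exact: i_slt.
    rewrite xE; apply: (lspan_map Hi) (gG _) => _ [z [k ->]].
    by apply: lspan_gen; exists (inl z), k.
  + case=> [y|c] n r /= Hr.
      apply: gT; suff [x [Hx xE']] : exists x, slt lt g y x /\ i x = r *: i (g y n).
        have -> : r *: g y n = x by apply/subr0_eq; apply: i_inj; rewrite (linB Hi) xE' (linZ Hi) subrr.
        by [].
      apply: (Hr (fun z => exists x, slt lt g y x /\ i x = z)).
        split=> [|s _ _ [u [Su <-]] [v [Sv <-]]].
          by exists 0; split; [exact: (sub0 (lspan_sub _)) | exact: lin0].
        exists (s *: u + v); split=> //.
        by apply: (subD (lspan_sub _)) => //; apply: (subZ (lspan_sub _)).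
      move=> _ [[z|z] [k [zy ->]]] //; exists (g z k); split=> //.
      by apply: lspan_gen; exists z, k.
    have [D [germ [Hg [_ [gk gsol]]]]] := germ_exists (R^o : lmodType R).
    pose ga (c' : X) m : D := if pselect (c' = c) then germ (fun k => tseg t m (k - m)) else 0.
    have gaE c' m : ga c' m - t m *: ga c' m.+1 = 0.
      rewrite /ga; case: pselect => ? /=; last by lmod.
      rewrite -(linZ Hg) -(linB Hg); apply/gk; exists m.+1 => k mk.
      rewrite -[LHS]/(tseg t m (k - m) - t m * tseg t m.+1 (k - m.+1)).
      by rewrite -(subnSK mk) tsegS subrr.
    have [h [Hh hi hx]] := map_out D (fun _ => 0) ga lin_zero gaE.
    have : h (r *: x_ c n) = 0.
      apply: (Hr _ (ker_sub Hh)) => _ [[z|z] [k [zc ->]]] /=; first exact: hi.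
      rewrite hx /ga; case: pselect => // zE.
      by case: (wo_irr woX (x := c)); rewrite -{1}zE.
    rewrite (linZ Hh) hx /ga; case: pselect => // ?.
    rewrite -(linZ Hg) => /gk [N /(_ (N + n)%N (leq_addr _ _))].
    by rewrite -[X in X = _ -> _]/(r * tseg t n (N + n - n)) addnK => E; exists N.
  + apply: G1gen => [|x|c n]; first exact: lspan_sub.
      apply: (lspan_map Hi) (gG x) => _ [z [k ->]].
      by apply: lspan_gen; exists (inl z), k.
    by apply: lspan_gen; exists (inr c), n.
- move=> c pc; exists (x_ c); split=> [n|n]; first exact: p1x.
  by rewrite xE /cl; case: pselect => // /(_ (pc n)).
- move=> x n px.
  suff [y [c [py E]]] : exists y c, p1 y = 0 /\ x = t n *: y + i c.
    exists y, c; split=> //.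
    by move: px; rewrite E (linD Hp1) (linZ Hp1) py scaler0 add0r p1i.
  move: x {px}; apply: G1gen => [|x|c k].
  + split=> [|r u v [y [c [py ->]]] [y' [c' [py' ->]]]].
      by exists 0, 0; rewrite (lin0 Hi) (lin0 Hp1); split=> //; lmod.
    exists (r *: y + y'), (r *: c + c'); rewrite Hp1 py py' Hi; split; lmod.
  + by exists 0, x; rewrite (lin0 Hp1); split=> //; lmod.
  + have [z zE] : exists z, x_ c k = tseg t k n *: x_ c (k + n)%N + i z.
      elim: (n) => [|d [z zE]]; first by exists 0; rewrite tseg0 addn0 (lin0 Hi); lmod.
      exists (z + tseg t k d *: cl c (k + d)%N).
      rewrite zE tsegSr addnS (linD Hi) (linZ Hi) -xE; lmod.
    (* Beyond index [k + n] the transition scalar is a multiple of [t n], which supplies the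
       divisibility. *)
    have [u uE] := tel_dvd_tel (e a) (leq_addl k n).
    exists ((tseg t k n * u) *: x_ c (k + n).+1), (z + tseg t k n *: cl c (k + n)%N).
    rewrite (linZ Hp1) p1x scaler0; split=> //.
    have tE : t (k + n)%N = t n * u by exact: uE.
    have X1 : x_ c (k + n)%N = t (k + n)%N *: x_ c (k + n).+1 + i (cl c (k + n)%N).
      by rewrite -xE; lmod.
    rewrite zE X1 tE (linD Hi) (linZ Hi); lmod.
Qed.
End Precover.

(** * Solving the systems of all products at once *)

Section AllSubsets.
Variables (R : comPzRingType) (m : nat) (e : 'I_m -> nat -> R).

Definition eJ (J : {set 'I_m}) (n : nat) : R := \prod_(j in J) e j n.

Lemma tel_eJ J n : tel (eJ J) n = tJ e J n.
Proof. by rewrite /tel /eJ /tJ exchange_big. Qed.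

Lemma tJ_split (J K : {set 'I_m}) n : tJ e (J :|: K) n = tJ e J n * tJ e (K :\: J) n.
Proof.
rewrite /tJ (big_setID J) /=; congr (_ * _); apply: eq_bigl => j; rewrite !inE;
  by case: (j \in J); case: (j \in K).
Qed.

Lemma tseg_mul (s t : nat -> R) n k : tseg (fun i => s i * t i) n k = tseg s n k * tseg t n k.
Proof. exact: big_split. Qed.

Variable F : lmodType R.

(* [reduces p J c]: the [J]-system [c] in [ker p] is solvable up to systems for
   strictly larger sets of indices. *)
Inductive reduces (G : lmodType R) (p : G -> F) (J : {set 'I_m}) : (nat -> G) -> Prop :=
| reduces_sol c x : (forall n, p (x n) = 0) -> system (tJ e J) c x -> reduces p J c
| reduces_add c (K : {set 'I_m}) b : reduces p J c -> J \proper K ->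
    (forall n, p (b n) = 0) ->
    reduces p J (fun n => c n + tseg (tJ e (K :\: J)) 0 n *: b n).

Lemma reduces_map (G G1 : lmodType R) (p : G -> F) (p1 : G1 -> F) (i : G -> G1) J c :
  is_linear i -> (forall x, p1 (i x) = p x) -> reduces p J c ->
  reduces p1 J (fun n => i (c n)).
Proof.
move=> Hi pi; elim=> {c} [c x px xc|c K b _ IH JK pb].
  apply: (reduces_sol (x := fun n => i (x n))) => n; first by rewrite pi.
  by rewrite -xc (linB Hi) (linZ Hi).
have -> : (fun n => i (c n + tseg (tJ e (K :\: J)) 0 n *: b n)) =
    (fun n => i (c n) + tseg (tJ e (K :\: J)) 0 n *: i (b n)).
  by apply/funext => n; rewrite (linD Hi) (linZ Hi).
by apply: reduces_add => // n; rewrite pi.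
Qed.

(** Descending induction on the size of [J]. If [y] solves the [K]-system for [b], then
    [tseg (tJ e (K :\: J)) 0 n *: y n] solves the [J]-system for the same multiple of [b n], since
    [tJ e K] is [tJ e J] times [tJ e (K :\: J)]. *)
Lemma reduces_solvable (G : lmodType R) (p : G -> F) : is_linear p ->
  (forall J c, (forall n, p (c n) = 0) -> reduces p J c) ->
  forall J c, (forall n, p (c n) = 0) ->
  exists x, (forall n, p (x n) = 0) /\ system (tJ e J) c x.
Proof.
move=> Hp Hred J; move: {2}(m - #|J|)%N (leqnn (m - #|J|)%N) => k.
elim: k J => [|k IH] J Hk c pc; have Hc := Hred J c pc.
  elim: Hc => {c pc} [c x px xc|c K b _ [x [px xc]] JK pb]; first by exists x.
  have : (#|J| < m)%N.
    by apply: leq_trans (proper_card JK) _; rewrite -[X in (_ <= X)%N]card_ord max_card.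
  by rewrite -subn_gt0; case: (m - #|J|)%N Hk.
elim: Hc => {c pc} [c x px xc|c K b _ [x [px xc]] JK pb]; first by exists x.
have [|y [py yb]] := IH K _ b pb.
  have JK' := proper_card JK; rewrite -ltnS; apply: leq_trans Hk.
  have KM : (#|K| <= m)%N by rewrite -[X in (_ <= X)%N]card_ord max_card.
  by apply: ltn_sub2l => //; exact: leq_trans JK' KM.
exists (fun n => x n + tseg (tJ e (K :\: J)) 0 n *: y n); split=> n.
  by rewrite (linD Hp) (linZ Hp) px py scaler0 addr0.
rewrite -xc -yb tsegSr add0n.
have -> : tJ e K n = tJ e J n * tJ e (K :\: J) n.
  by rewrite -tJ_split; congr tJ; apply/esym/setUidPr; exact: proper_sub.
set s := tseg _ _ _; lmod.
Qed.

(** The head [J0] of the list is adjoined last. For an earlier [J], the entries of [c] are multiples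
    of [tseg (tJ e J0) 0 n] up to the old kernel; such multiples contain the factor of [J0 :\: J],
    which reduces them to the set [J :|: J0]. It is strictly larger than [J] because [J0] is not
    contained in [J]. *)
Lemma precover_list (Q : lmodType R) (T : Type) (b : T -> Q) (q : Q -> F) (s : seq {set 'I_m}) :
  free_on b -> is_linear q -> pairwise (fun J K : {set 'I_m} => ~~ (J \subset K)) s ->
  exists (G : lmodType R) (i : Q -> G) (p : G -> F),
  [/\ is_linear i /\ is_linear p, forall x, p (i x) = q x, telescoping eJ G &
      forall J c, J \in s -> (forall n, p (c n) = 0) -> reduces p J c].
Proof.
move=> Hb Hq; elim: s => [_|J0 s IH] /=.
  exists Q, id, q; split=> //; apply: (@free_telescoping _ _ _ _ _ b set0) => // n.
  by rewrite tel_eJ /tJ big_set0.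
move=> /andP [/allP Hs /IH [G [i [p [[Hi Hp] pi Gt Gr]]]]].
have [G1 [i1 [p1 [[Hi1 Hp1] p1i G1t G1s G1d]]]] := @adjoin_solutions R _ eJ G F p J0 Hp Gt.
exists G1, (fun x => i1 (i x)), p1; split=> //.
- by split=> //; exact: lin_comp.
- by move=> x; rewrite p1i.
move=> J c; rewrite inE => /orP [/eqP ->|Js] pc.
  have /choice [S SP] : forall nx : nat * G1, exists yd : G1 * G,
      p1 nx.2 = 0 -> [/\ p1 yd.1 = 0, p yd.2 = 0 & nx.2 = tJ e J0 nx.1 *: yd.1 + i1 yd.2].
    move=> [n x]; have [px|nx] := EM (p1 x = 0); last by exists (0, 0).
    by have [y [d H]] := G1d x n px; exists (y, d); rewrite /= -tel_eJ.
  (* For [J0] itself the system is solved step by step, dividing by the scalar each time. The errors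
     [d n] lie in the old kernel and are absorbed by the adjoined solution [z]. *)
  pose x := fix x n := if n is n'.+1 then (S (n', x n' - c n')).1 else 0.
  have px n : p1 (x n) = 0.
    elim: n => [|n IHn]; first exact: lin0.
    by have [|] := SP (n, x n - c n) => //=; rewrite (linB Hp1) IHn pc subrr.
  have pxc n : p1 (x n - c n) = 0 by rewrite (linB Hp1) px pc subrr.
  pose d n := (S (n, x n - c n)).2.
  have pd n : p (d n) = 0 by have [] := SP (n, x n - c n) (pxc n).
  have dE n : x n - c n = tJ e J0 n *: x n.+1 + i1 (d n).
    by have [] := SP (n, x n - c n) (pxc n).
  have [z [pz zE]] := G1s d pd.
  apply: (reduces_sol (x := fun n => x n - z n)) => n.
    by rewrite (linB Hp1) px pz subrr.
  have := zE n; rewrite tel_eJ => zn.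
  have -> : c n = x n - (tJ e J0 n *: x n.+1 + i1 (d n)) by rewrite -dE; lmod.
  rewrite -zn; lmod.
have div N x : p1 x = 0 -> exists y d,
    [/\ p1 y = 0, p d = 0 & x = tseg (tJ e J0) 0 N *: y + i1 d].
  move=> px; elim: N => [|N [y [d [py pd E]]]].
    by exists x, 0; rewrite tseg0 (lin0 Hp) (lin0 Hi1); split=> //; lmod.
  have [y' [d' [py' pd' E']]] := G1d y N py; rewrite tel_eJ in E'.
  exists y', (d + tseg (tJ e J0) 0 N *: d'); split=> //.
    by rewrite (linD Hp) (linZ Hp) pd pd' scaler0 addr0.
  by rewrite E E' tsegSr add0n (linD Hi1) (linZ Hi1); set s0 := tseg _ _ _; lmod.
have /choice [yd ydP] : forall n, exists yd : G1 * G,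
    [/\ p1 yd.1 = 0, p yd.2 = 0 & c n = tseg (tJ e J0) 0 n *: yd.1 + i1 yd.2].
  by move=> n; have [y [d H]] := div n (c n) (pc n); exists (y, d).
have splitJ n : tJ e J0 n = tJ e ((J :|: J0) :\: J) n * tJ e (J0 :&: J) n.
  have -> : (J :|: J0) :\: J = J0 :\: J by rewrite setDUl setDv set0U.
  have := tJ_split (J0 :&: J) J0 n.
  have -> : J0 :&: J :|: J0 = J0 by apply/setUidPr; exact: subsetIl.
  have -> : J0 :\: (J0 :&: J) = J0 :\: J by rewrite setDIr setDv set0U.
  by move=> ->; rewrite mulrC.
have cE : c = (fun n => i1 (yd n).2 + tseg (tJ e ((J :|: J0) :\: J)) 0 n *:
    (tseg (tJ e (J0 :&: J)) 0 n *: (yd n).1)).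
  apply/funext => n; have [_ _ ->] := ydP n.
  rewrite addrC scalerA -tseg_mul; congr (_ + tseg _ _ _ *: _).
  by apply/funext => k.
rewrite cE; apply: (reduces_add (c := fun n => i1 (yd n).2)).
- apply: (reduces_map Hi1 p1i (c := fun n => (yd n).2)); apply: Gr => // n.
  by have [] := ydP n.
- rewrite properE subsetUl /=; apply: contra (Hs _ Js) => H.
  exact: subset_trans (subsetUr _ _) H.
- by move=> n; have [H _ _] := ydP n; rewrite (linZ Hp1) H scaler0.
Qed.

Lemma precover (Q : lmodType R) (T : Type) (b : T -> Q) (q : Q -> F) :
  free_on b -> is_linear q ->
  exists (G : lmodType R) (i : Q -> G) (p : G -> F),
  [/\ is_linear i /\ is_linear p, forall x, p (i x) = q x, telescoping eJ G &
      forall J c, (forall n, p (c n) = 0) ->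
        exists x, (forall n, p (x n) = 0) /\ system (tJ e J) c x].
Proof.
move=> Hb Hq.
(* Decreasing size, since the tail of the list is treated first; a set contained in a later one
   would have to equal it. *)
pose leT (J K : {set 'I_m}) := (#|K| <= #|J|)%N.
pose s := sort leT (enum {set 'I_m}).
have [|G [i [p [[Hi Hp] pi Gt Gr]]]] := @precover_list Q T b q s Hb Hq.
  have tr : transitive leT by move=> y x z xy yz; exact: leq_trans yz xy.
  have tot : total leT by move=> x y; exact: leq_total.
  have us : uniq s by rewrite sort_uniq enum_uniq.
  have ps : pairwise leT s by rewrite -sorted_pairwise // sort_sorted.
  have : pairwise (fun J K => leT J K && (J != K)) s by rewrite pairwise_relI ps -uniq_pairwise.
  apply: sub_pairwise => J K /andP [JK nJK]; apply: contra nJK => sJK.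
  by rewrite eqEcard sJK.
exists G, i, p; split=> //; apply: reduces_solvable => // J c pc.
by apply: Gr => //; rewrite mem_sort mem_enum.
Qed.
End AllSubsets.

(** * Reduction and lifting modulo the ideal *)

Lemma telescoping_fqf (R : comPzRingType) (A : finType) (e : A -> nat -> R)
  (F G : lmodType R) : telescoping e G -> direct_summand F G -> finitely_quite_flat F.
Proof.
move=> /telescoping_transfinite [O [lt [sg [M [H1 [H2 [H3 [H4 [H5 [H6 [H7 H8]]]]]]]]]]] Hds.
exists #|A|, (fun j => mon (e (enum_val j))); split; first by move=> j; exact: mon_countable.
exists G; split=> //; exists O, lt, sg, M; do 7!split=> //.
move=> a b ab Hb; have [C [[x Cx] HC]] := H8 a b ab Hb; exists C; split=> //.
by right; exists (enum_rank x); rewrite enum_rankK.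
Qed.

Definition with_one (R : comPzRingType) (J : Type) (e : J -> nat -> R) (a : option J) :=
  if a is Some j then e j else fun _ => 1.

Lemma fqf_telescoping (R : comPzRingType) (F : lmodType R) : finitely_quite_flat F ->
  exists m (e : 'I_m -> nat -> R) (G : lmodType R),
    telescoping (with_one e) G /\ direct_summand F G.
Proof.
move=> [m [S [HS [G [HG Hds]]]]].
have [e eE] := choice (fun j => countable_mon (HS j)).
exists m, e, G; split=> //; apply: transfinite_telescoping HG => C [HC|[j HC]].
  by have [c Hc] := iso_R_telescope HC; exists None, c.
by rewrite eE in HC; have [c Hc] := loc_telescope HC; exists (Some j), c.
Qed.

Section Semilinear.
Variables (R R' : comPzRingType) (pi : {rmorphism R -> R'}).
Hypothesis pi_surj : forall r', exists r, pi r = r'.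

Lemma semi0 (M : lmodType R) (M' : lmodType R') (f : M -> M') : semilinear pi f -> f 0 = 0.
Proof. by move=> [_ fZ]; rewrite -(scale0r 0) fZ rmorph0 scale0r. Qed.
Lemma semiB (M : lmodType R) (M' : lmodType R') (f : M -> M') : semilinear pi f ->
  forall x y, f (x - y) = f x - f y.
Proof. by move=> [fD fZ] x y; rewrite -scaleN1r fD fZ rmorphN1 scaleN1r. Qed.
Lemma semi_comp_lin (M N : lmodType R) (M' : lmodType R') (f : N -> M') (g : M -> N) :
  semilinear pi f -> is_linear g -> semilinear pi (fun x => f (g x)).
Proof.
by move=> [fD fZ] Hg; split=> [x y|a x]; rewrite ?(linD Hg) ?(linZ Hg) ?fD ?fZ.
Qed.
Lemma lin_comp_semi (M : lmodType R) (M' N' : lmodType R') (f : M' -> N') (g : M -> M') :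
  is_linear f -> semilinear pi g -> semilinear pi (fun x => f (g x)).
Proof.
by move=> Hf [gD gZ]; split=> [x y|a x]; rewrite ?gD ?gZ ?(linD Hf) ?(linZ Hf).
Qed.

Lemma semi_preim_sub (M : lmodType R) (M' : lmodType R') (f : M -> M') (A : M' -> Prop) :
  semilinear pi f -> submodule A -> submodule (fun x => A (f x)).
Proof.
move=> Hf HA; have [fD fZ] := Hf; split=> [|a x y Ax Ay].
  by rewrite (semi0 Hf); exact: sub0.
by rewrite fD fZ; case: HA => _; apply.
Qed.

Lemma semi_lspan (M : lmodType R) (M' : lmodType R') (f : M -> M')
  (X : M -> Prop) (X' : M' -> Prop) : semilinear pi f ->
  (forall x, X x -> X' (f x)) -> forall x, lspan X x -> lspan X' (f x).
Proof.
move=> Hf XX x Hx; apply: (Hx _ (semi_preim_sub Hf (lspan_sub X'))) => y /XX.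
exact: lspan_gen.
Qed.

Lemma semi_lspan_lift (M : lmodType R) (M' : lmodType R') (f : M -> M')
  (X : M -> Prop) (X' : M' -> Prop) : semilinear pi f ->
  (forall x', X' x' -> exists x, X x /\ f x = x') ->
  forall x', lspan X' x' -> exists x, lspan X x /\ f x = x'.
Proof.
move=> Hf XX x' Hx'; have [fD fZ] := Hf.
apply: (Hx' (fun x' => exists x, lspan X x /\ f x = x')) => [|y /XX [x [Xx <-]]].
  split=> [|a _ _ [x [Hx <-]] [y [Hy <-]]].
    by exists 0; split; [exact: (sub0 (lspan_sub _)) | exact: semi0].
  have [r <-] := pi_surj a; exists (r *: x + y); split; last by rewrite fD fZ.
  by case: (lspan_sub X) => _; apply.
by exists x; split=> //; exact: lspan_gen.
Qed.

Lemma free_semilinear (T : Type) (Q : lmodType R) (b : T -> Q) (M' : lmodType R')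
  (g : T -> M') : free_on b -> exists f, semilinear pi f /\ forall t, f (b t) = g t.
Proof.
move=> Hb; have [M [k [[kD kZ] [k' kK kK']]]] := restrict_exists pi M'.
have [h [Hh hE]] := Hb.1 M (fun t => k' (g t)).
exists (fun x => k (h x)); split; first exact: semi_comp_lin.
by move=> t; rewrite hE kK'.
Qed.

Lemma projective_semi (P E : lmodType R) (M' : lmodType R') (f : E -> M') (g : P -> M') :
  projective P -> semilinear pi f -> (forall y, exists x, f x = y) -> semilinear pi g ->
  exists h : P -> E, is_linear h /\ forall x, f (h x) = g x.
Proof.
move=> HP Hf fs Hg; have [M [k [[kD kZ] [k' kK kK']]]] := restrict_exists pi M'.
have lin (N : lmodType R) (u : N -> M') : semilinear pi u -> is_linear (fun x => k' (u x)).
  move=> [uD uZ] a x y; apply: (can_inj kK); rewrite kK' kD kZ !kK'.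
  by rewrite uD uZ.
have [|h [Hh hE]] := HP _ _ _ _ (lin _ _ Hf) (lin _ _ Hg).
  by move=> y; have [x xE] := fs (g y); exists x; rewrite xE.
by exists h; split=> // x; apply: (can_inj kK'); exact: hE.
Qed.

Lemma rmorph_tel (e : nat -> R) n : pi (tel e n) = tel (fun k => pi (e k)) n.
Proof. exact: rmorph_prod. Qed.
Lemma rmorph_tseg (e : nat -> R) n k :
  pi (tseg (tel e) n k) = tseg (tel (fun k => pi (e k))) n k.
Proof. by rewrite rmorph_prod; apply: eq_bigr => i _; exact: rmorph_tel. Qed.

Variables (I : R -> Prop) (A : Type) (e : A -> nat -> R).
Hypothesis I_pi : forall r, pi r = 0 <-> I r.

(** Stated along a surjection [pi] to serve twice: for [R -> R/I] it lifts to [R] the presentation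
    of an [R/I]-module, and for the identity with zero ideal it presents an [R]-module. *)
Lemma presentation (G : lmodType R') (Y : Type) (lt : Y -> Y -> Prop) (ty : Y -> A)
  (g : Y -> nat -> G) (Q : lmodType R) (b : Y * nat -> Q) (ev : Q -> G) :
  tele_data (fun a n => pi (e a n)) lt ty g -> free_on b -> semilinear pi ev ->
  (forall y n, ev (b (y, n)) = g y n) ->
  exists (h : Y -> nat -> Q) (rho : Q -> Q),
  [/\ forall y n, below lt b y (h y n), is_linear rho,
      forall y n, rho (b (y, n)) = b (y, n) - tel (e (ty y)) n *: b (y, n.+1) - h y n &
      forall x, ev x = 0 <-> exists c, ideal_times I (x - rho c)].
Proof.
move=> [wo gS gT gG] Hb Hev evE; have [evD evZ] := Hev.
have lift y x : slt lt g y x -> exists z, below lt b y z /\ ev z = x.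
  apply: (semi_lspan_lift Hev) => _ [z [n [zy ->]]].
  by exists (b (z, n)); split; [exists z, n | exact: evE].
have /choice [h hP] : forall yn : Y * nat, exists z, below lt b yn.1 z /\
    ev z = g yn.1 yn.2 - tel (fun k => pi (e (ty yn.1) k)) yn.2 *: g yn.1 yn.2.+1.
  by move=> [y n]; apply: lift; exact: gS.
have [rho [Hrho rhoE]] := Hb.1 Q (fun yn =>
  b yn - tel (e (ty yn.1)) yn.2 *: b (yn.1, yn.2.+1) - h yn).
have ev_rho x : ev (rho x) = 0.
  have Hs := semi_preim_sub (semi_comp_lin Hev Hrho) (ker_sub lin_id).
  move: x; apply: (Hb.2 _ Hs) => -[y n].
  by rewrite rhoE !(semiB Hev) evZ !evE (hP (y, n)).2 rmorph_tel subrr.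
have Hh y n : below lt b y (h (y, n)) := (hP (y, n)).1.
have rhoE' y n : rho (b (y, n)) = b (y, n) - tel (e (ty y)) n *: b (y, n.+1) - h (y, n).
  exact: (rhoE (y, n)).
have I_pi' r : I r <-> pi r = 0 by split=> /I_pi.
have tors y n r' x : below lt b y x -> r' *: g y n = ev x ->
    exists k, r' * pi (tseg (tel (e (ty y))) n k) = 0.
  move=> Hx E; have [|k Hk] := gT y n r'; last by exists k; rewrite rmorph_tseg.
  rewrite E; apply: (semi_lspan Hev) Hx => _ [z [k [zy ->]]].
  by exists z, k; rewrite evE.
exists (fun y n => h (y, n)), rho; split=> // x; split.
  exact: (@ker_ev R Y lt wo Q b (fun y => tel (e (ty y))) Hb (fun y n => h (y, n)) rho
    Hh Hrho rhoE' I R' pi G g ev Hev evE I_pi' tors ev_rho x).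
exact: (@ev_imI R Q rho I R' pi G ev Hev I_pi' ev_rho x).
Qed.
End Semilinear.

Section Reduction.
Variables (R R' : comPzRingType) (I : R -> Prop) (pi : {rmorphism R -> R'}).
Hypotheses (HI : ideal I) (pi_surj : forall r', exists r, pi r = r').
Hypothesis I_pi : forall r, pi r = 0 <-> I r.

(** Only the torsion condition is not formal: over [R] the element [r *: g y n] lies in the earlier
    span merely up to [IG]. Lifted to the free module [Q], this becomes a congruence modulo [IQ] and
    the image of [rho], which [rho_torsion] handles. *)
Lemma telescoping_reduction (A : Type) (e : A -> nat -> R) (G : lmodType R)
  (G' : lmodType R') (ka : G -> G') : telescoping e G -> semilinear pi ka ->
  (forall y, exists x, ka x = y) -> (forall x, ka x = 0 <-> ideal_times I x) ->
  telescoping (fun a n => pi (e a n)) G'.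
Proof.
move=> [Y [lt [ty [g Hg]]]] Hka kas kak; have [wo gS gT gG] := Hg; have [kD kZ] := Hka.
exists Y, lt, ty, (fun y n => ka (g y n)); split=> //.
- move=> y n; rewrite -rmorph_tel -kZ -(semiB Hka).
  apply: (semi_lspan Hka) (gS y n) => _ [z [k [zy ->]]].
  by exists z, k.
- move=> y n r' Hr; have [r rE] := pi_surj r'.
  have [x [Hx xE]] : exists x, slt lt g y x /\ ka x = r' *: ka (g y n).
    apply: (semi_lspan_lift pi_surj Hka) Hr => _ [z [k [zy ->]]].
    by exists (g z k); split=> //; exists z, k.
  have Ix : ideal_times I (r *: g y n - x).
    by apply/kak; rewrite (semiB Hka) kZ xE rE subrr.
  have [Q [b [Hb _]]] := free_exists R (Y * nat)%type.
  have [ev [Hev evE]] := Hb.1 G (fun yn => g yn.1 yn.2).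
  have evs z : exists x, ev x = z.
    have [x' [_ x'E]] : exists x', lspan (fun q => exists yn, q = b yn) x' /\ ev x' = z.
      apply: (@semi_lspan_lift R R idfun (fun r => ex_intro _ r erefl) _ _ ev) (gG z).
        by split; [exact: linD | exact: linZ].
      by move=> _ [w [k ->]]; exists (b (w, k)); split; [exists (w, k) | rewrite evE].
    by exists x'.
  have Hev' : semilinear idfun ev by split; [exact: linD | exact: linZ].
  have I0 r0 : idfun r0 = 0 <-> r0 = 0 :> R by [].
  have [h [rho [Hh Hrho rhoE kerE]]] := @presentation R R idfun
    (fun r => ex_intro _ r erefl) (fun r => r = 0) A e I0 G Y lt ty g Q b ev Hg Hb Hev'
    (fun y n => evE (y, n)).
  have [x1 [Hx1 x1E]] : exists x1, below lt b y x1 /\ ev x1 = x.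
    apply: (@semi_lspan_lift R R idfun (fun r => ex_intro _ r erefl) _ _ ev _ _ Hev') Hx.
    by move=> _ [w [k [wy ->]]]; exists (b (w, k)); split; [exists w, k | rewrite evE].
  have [z [Iz zE]] := it_surj Hev evs Ix.
  have [|c Hc] := (kerE (r *: b (y, n) - x1 - z)).1.
    by rewrite !(linB Hev) (linZ Hev) evE zE x1E subrr.
  have {}Hc : r *: b (y, n) - x1 - z - rho c = 0.
    by apply: (it_killed _ Hc) => a d ->; rewrite scale0r.
  have [||k Hk] := @rho_torsion R Y lt wo Q b (fun y => tel (e (ty y))) Hb h rho Hh Hrho rhoE
    I HI r y n ((-1) *: x1) c.
  + exact: (subZ (lspan_sub _)).
  + have -> : r *: b (y, n) + -1 *: x1 - rho c = z + (r *: b (y, n) - x1 - z - rho c) by lmod.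
    by rewrite Hc addr0.
  by exists k; rewrite -rE -rmorph_tseg -rmorphM; apply/I_pi.
- move=> y; have [x <-] := kas y; apply: (semi_lspan Hka) (gG x) => _ [z [k ->]].
  by exists z, k.
Qed.

Variables (F : lmodType R) (F' : lmodType R') (p : F -> F').
Hypotheses (Hp : semilinear pi p) (ps : forall y, exists x, p x = y)
  (p_ker : forall x, p x = 0 <-> ideal_times I x).

Lemma fqf_reduction : finitely_quite_flat F -> finitely_quite_flat F'.
Proof.
move=> /fqf_telescoping [m [e [G [HG [i [r [Hi [Hr ri]]]]]]]].
have [W [om [Hom [oms omk]]]] := quotient_exists (it_sub I G).
have Wk a : pi a = 0 -> forall w : W, a *: w = 0.
  move=> /I_pi Ia w; have [x <-] := oms w.
  by rewrite -(linZ Hom); apply/omk; exact: it_gen.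
have [G' [k [Hk [k' kK kK']]]] := extend_exists pi_surj Wk.
pose ka x := k (om x).
have Hka : semilinear pi ka by exact: (semi_comp_lin Hk Hom).
have kas y : exists x, ka x = y.
  by have [x xE] := oms (k' y); exists x; rewrite /ka xE kK'.
have kak x : ka x = 0 <-> ideal_times I x.
  rewrite -omk /ka; split=> [E|->]; last exact: semi0 Hk.
  by apply: (can_inj kK); rewrite E (semi0 Hk).
have factor (M N : lmodType R) (M' N' : lmodType R') (a : M -> M') (c : N -> N') (f : M -> N) :
    semilinear pi a -> (forall y, exists x, a x = y) ->
    (forall x, a x = 0 -> ideal_times I x) -> semilinear pi c ->
    (forall x, ideal_times I x -> c x = 0) -> is_linear f ->
    exists f' : M' -> N', is_linear f' /\ forall x, f' (a x) = c (f x).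
  move=> Ha as_ ak Hc ck Hf; have [s sE] := choice as_.
  have [[aD aZ] [cD cZ]] := (Ha, Hc).
  have E x : c (f (s (a x))) = c (f x).
    apply/subr0_eq; rewrite -(semiB Hc) -(linB Hf); apply: ck; apply: (it_lin Hf).
    by apply: ak; rewrite (semiB Ha) sE subrr.
  exists (fun y => c (f (s y))); split=> // r' y z; have [r0 <-] := pi_surj r'.
  by rewrite -{1}(sE y) -{1}(sE z) -aZ -aD E Hf cD cZ.
have [i' [Hi' i'E]] := factor _ _ _ _ _ _ _ Hp ps (fun x => (p_ker x).1) Hka
  (fun x => (kak x).2) Hi.
have [r' [Hr' r'E]] := factor _ _ _ _ _ _ _ Hka kas (fun x => (kak x).1) Hp
  (fun x => (p_ker x).2) Hr.
apply: (telescoping_fqf (telescoping_reduction HG Hka kas kak)).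
exists i', r'; split=> //; split=> // y.
by have [x <-] := ps y; rewrite i'E r'E ri.
Qed.

Hypotheses (HT : T_nilpotent I) (Hflat : flat F).

Lemma fqf_lift : finitely_quite_flat F' -> finitely_quite_flat F.
Proof.
move=> /fqf_telescoping [m [e' [G' [[Y [lt [ty [g Hg]]]] [i' [p' [Hi' [Hp' pi']]]]]]]].
have [e eE] : exists e : 'I_m -> nat -> R, forall j n, pi (e j n) = e' j n.
  have [f fE] := choice (fun jn : 'I_m * nat => pi_surj (e' jn.1 jn.2)).
  by exists (fun j n => f (j, n)) => j n; exact: (fE (j, n)).
have {}Hg : tele_data (fun a n => pi (with_one e a n)) lt ty g.
  suff -> : (fun a n => pi (with_one e a n)) = with_one e' by [].
  apply/funext => -[j|]; apply/funext => n /=; [exact: eE | exact: rmorph1].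
have [wo _ _ gG] := Hg.
have [Q [b [Hb HQ]]] := free_exists R (Y * nat)%type.
have HQp := free_projective Hb.
have [ev [Hev evE]] := free_semilinear pi (fun yn => g yn.1 yn.2) Hb.
have evs z : exists x, ev x = z.
  have [x' [_ x'E]] : exists x', lspan (fun q => exists yn, q = b yn) x' /\ ev x' = z.
    apply: (semi_lspan_lift pi_surj Hev) (gG z).
    by move=> _ [w [k ->]]; exists (b (w, k)); split; [exists (w, k) | rewrite evE].
  by exists x'.
have [h [rho [Hh Hrho rhoE kerE]]] := presentation pi_surj I_pi Hg Hb Hev (fun y n => evE (y, n)).
(* [q] lifts the projection onto [F/IF], and [u] lifts the idempotent [i' \o p'] of [G']. *)
have [q [Hq qE]] := projective_semi HQp Hp ps (lin_comp_semi Hp' Hev).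
have [u [Hu uE]] := projective_semi HQp Hev evs (lin_comp_semi Hi' (lin_comp_semi Hp' Hev)).
have qs y : exists x, q x = y.
  have H x : exists z, (exists w, z = q w) /\ ideal_times I (x - z).
    have [w wE] := evs (i' (p x)); exists (q w); split; first by exists w.
    by apply/p_ker; rewrite (semiB Hp) qE wE pi' subrr.
  by have [w ->] := tnil_nakayama HT (im_sub Hq) H y; exists w.
have [L [io [Hio [io_inj io_im]]]] := submodule_exists (ker_sub Hq).
have q_io l : q (io l) = 0 by apply/io_im; exists l.
have q_it x : ideal_times I (q x) -> exists l, ideal_times I (x - io l).
  move=> Ix; have [z [Iz zE]] := it_surj Hq qs Ix.
  have [|l lE] := (io_im (x - z)).1; first by rewrite (linB Hq) zE subrr.
  by exists l; rewrite lE; have -> : x - (x - z) = z by lmod.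
have rho_inj c : ideal_times I (rho c) -> ideal_times I c.
  exact: (@rho_inj_mod R Y lt wo Q b (fun y => tel (with_one e (ty y))) Hb h rho Hh Hrho rhoE I c).
have u_ker l : exists c, ideal_times I (u (io l) - rho c).
  by apply/kerE; rewrite uE -qE q_io (semi0 Hp) (lin0 Hi').
have u_compl x : exists l, ideal_times I (x - u x - io l).
  apply: q_it; apply/p_ker; rewrite qE (semiB Hev) (linB Hp') uE pi' subrr //.
have rho_ker c : exists l, ideal_times I (rho c - io l).
  apply: q_it; apply/p_ker; rewrite qE.
  have -> : ev (rho c) = 0 by apply/kerE; exists c; rewrite subrr; exact: (sub0 (it_sub _ _)).
  exact: lin0.
have HLp : projective L.
  exact: (syzygy_projective HI HT Hflat Hq qs Hio io_inj io_im HQ HQp Hrho Hu rho_inj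
    u_ker u_compl rho_ker).
have ext_killed (D : lmodType R) : (forall a (d : D), I a -> a *: d = 0) ->
    (forall j, solvable_for (tel (e j)) D) -> extendable io D.
  move=> Dk Ds phi Hphi.
  apply: (extend_killed HI Hflat Hq qs Hio io_inj io_im HQp Hrho Hu u_ker u_compl rho_ker Dk) => // f Hf.
  apply: (@extend_along_rho R Y lt wo Q b (fun y => tel (with_one e (ty y))) Hb h rho Hh Hrho rhoE) => // y.
  case: (ty y) => [j|]; first exact: Ds.
  by apply: solvable_divisible => n x; exists x; rewrite /= tel_one scale1r.
have [G [i [p0 [[Hi Hp0] p0i Gt Gs]]]] := precover e Hb Hq.
have [K [jk [Hjk [jki jkP]]]] := submodule_exists (ker_sub Hp0).
have Ksol J : solvable_for (tJ e J) K.
  move=> c; have [|x [px xc]] := Gs J (fun n => jk (c n)).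
    by move=> n; apply/jkP; exists (c n).
  have [y yE] := choice (fun n => (jkP (x n)).1 (px n)).
  by exists y => n; apply: jki; rewrite (linB Hjk) (linZ Hjk) !yE xc.
have [|phi [Hphi phiE]] := factor_inj Hjk jki (lin_comp Hi Hio).
  by move=> l; apply/jkP; rewrite p0i.
have [Phi [HPhi PhiE]] := all_solvable_extendable HT Hio HQp HLp ext_killed Ksol Hphi.
(* On [L = ker q] the map [i] takes values in [K = ker p0], and there it agrees with [Phi].
   Subtracting the extension [Phi] makes [i] factor through [F], as a section of [p0]. *)
have [||s [Hs sE]] := @factor_surj _ _ _ _ q (fun x => i x - jk (Phi x)) Hq qs.
- by apply: lin_sub => //; exact: lin_comp.
- by move=> x /io_im [l <-]; rewrite PhiE phiE subrr.
apply: (telescoping_fqf Gt); exists s, p0; split=> //; split=> // y.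
have [x <-] := qs y; rewrite sE (linB Hp0) p0i.
by rewrite ((jkP _).2 (ex_intro _ (Phi x) erefl)) subr0.
Qed.
End Reduction.

(* R' with pi : R ->> R' (kernel I) is the quotient ring R/I, and
   F' with p : F ->> F' (kernel IF, p(a x) = pi(a) p(x)) is the
   R/I-module F/IF. *)
Theorem theorem5p4 (R : comPzRingType) (I : R -> Prop)
  (HI : ideal I) (HT : T_nilpotent I)
  (F : lmodType R) (Hflat : flat F)
  (R' : comPzRingType) (pi : {rmorphism R -> R'})
  (Hpi_surj : forall r', exists r, pi r = r')
  (Hpi_ker : forall r, pi r = 0 <-> I r)
  (F' : lmodType R') (p : F -> F')
  (Hp_add : forall x y, p (x + y) = p x + p y)
  (Hp_scale : forall (a : R) (x : F), p (a *: x) = pi a *: p x)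
  (Hp_surj : forall y, exists x, p x = y)
  (Hp_ker : forall x, p x = 0 <-> ideal_times I x) :
  finitely_quite_flat F <-> finitely_quite_flat F'.
Proof.
have Hp : semilinear pi p by split.
split; first exact: (fqf_reduction HI Hpi_surj Hpi_ker Hp).
exact: (fqf_lift HI Hpi_surj Hpi_ker Hp).
Qed.
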